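(* Let $A$ be a unital (complex) $C^*$-algebra with non-trivial center (i.e. the center of $A$ has dimension greater than one). Then $\Phi_A(\delta)=\Phi_A^S(\delta)=\sqrt{2\delta}$ for every $\delta\in(0,1/2]$.
   Context: For a (real or complex) Banach space $X\neq\{0\}$, $B_X$ and $S_X$ denote its closed unit ball and unit sphere, $X^*$ its topological dual, and $\Pi(X):=\{(x,x^* )\in X\times X^* : \|x\|=\|x^*\|=x^*(x)=1\}$. The Bishop-Phelps-Bollobás modulus $\Phi_X:(0,2)\to[0,\infty)$ is defined as follows: $\Phi_X(\delta)$ is the infimum of those $\varepsilon>0$ such that for every $(x,x^* )\in B_X\times B_{X^*}$ with $\operatorname{Re} x^*(x)>1-\delta$ there is $(y,y^* )\in\Pi(X)$ with $\|x-y\|<\varepsilon$ and $\|x^*-y^*\|<\varepsilon$. The spherical Bishop-Phelps-Bollobás modulus $\Phi_X^S:(0,2)\to[0,\infty)$ is defined in the same way with $B_X\times B_{X^*}$ replaced by $S_X\times S_{X^*}$. For a $C^*$-algebra $A$, the symbols $\Phi_A$, $\Phi_A^S$ refer to $A$ regarded as a Banach space. *)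

(* Defs.v *)
From HB Require Import structures.
From mathcomp Require Import all_boot all_order all_algebra.
From mathcomp Require Import complex.
From mathcomp Require Import boolp classical_sets reals topology normedtype.
Set Implicit Arguments.
Unset Strict Implicit.
Unset Printing Implicit Defensive.
Import Order.TTheory GRing.Theory Num.Theory.
Import numFieldNormedType.Exports.
Local Open Scope classical_set_scope.
Local Open Scope complex_scope.
Local Open Scope ring_scope.

(* The complex modulus as an element of R; `|z| is its image in R[i]. *)
Notation normc := ComplexField.Normc.normc.

(* Unital C*-algebras up to completeness. An algType is unital, with 1 != 0. *)
HB.mixin Record isPreCStar (R : realType) A & GRing.Algebra R[i] A := {
  star : A -> A ;
  starK : involutive star ;
  starD : forall x y : A, star (x + y) = star x + star y ;
  starZ : forall (c : R[i]) (x : A), star (c *: x) = Num.conj c *: star x ;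
  starM : forall x y : A, star (x * y) = star y * star x ;
  cnorm : A -> R ;
  cnormD : forall x y : A, cnorm (x + y) <= cnorm x + cnorm y ;
  cnormZ : forall (c : R[i]) (x : A), cnorm (c *: x) = normc c * cnorm x ;
  cnorm0_eq0 : forall x : A, cnorm x = 0 -> x = 0 ;
  cnormM : forall x y : A, cnorm (x * y) <= cnorm x * cnorm y ;
  cnorm_star_mul : forall x : A, cnorm (star x * x) = cnorm x ^+ 2
}.

#[short(type="preCStarAlgType")]
HB.structure Definition PreCStarAlgebra (R : realType) :=
  {A of GRing.Algebra R[i] A & isPreCStar R A}.

(* A regarded as a normed space. The alias is needed because Hierarchy-Builder
   rejects a structure joining algType and normedModType: it would compete with
   numDomainType as join of the ring and normed Z-module classes. *)
Definition banach (R : realType) (A : preCStarAlgType R) : Type := A.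

Section Banach.
Variables (R : realType) (A : preCStarAlgType R).

HB.instance Definition _ := GRing.Lmodule.on (banach A).

Definition banach_norm (x : banach A) : R[i] := (cnorm (x : A))%:C.

Lemma banach_normD x y : banach_norm (x + y) <= banach_norm x + banach_norm y.
Proof. by rewrite /banach_norm -rmorphD /= lecR; exact: cnormD. Qed.

Lemma banach_normZ (c : R[i]) x :
  banach_norm (c *: x) = `|c| * banach_norm x.
Proof. by rewrite /banach_norm [X in X%:C]cnormZ rmorphM. Qed.

Lemma banach_norm0_eq0 x : banach_norm x = 0 -> x = 0.
Proof. by case=> /cnorm0_eq0. Qed.

HB.instance Definition _ := Lmodule_isNormed.Build R[i] (banach A)
  banach_normD banach_normZ banach_norm0_eq0.

End Banach.

HB.mixin Record isCStarComplete (R : realType) A & PreCStarAlgebra R A := {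
  cstar_complete : forall F : set_system (banach A),
    ProperFilter F -> cauchy F -> cvg F
}.

#[short(type="cstarAlgType")]
HB.structure Definition CStarAlgebra (R : realType) :=
  {A of PreCStarAlgebra R A & isCStarComplete R A}.

HB.instance Definition _ (R : realType) (A : cstarAlgType R) :=
  Uniform_isComplete.Build (banach A) (@cstar_complete R A).

Section Dimension.
Variables (K : fieldType) (V : lmodType K).

Definition lin_indep n (v : 'I_n -> V) : Prop :=
  forall c : 'I_n -> K, \sum_(i < n) c i *: v i = 0 -> forall i, c i = 0.

(* The linear subspace S, possibly infinite-dimensional, has dimension greater
   than n. *)
Definition dim_gt (n : nat) (S : set V) : Prop :=
  exists v : 'I_n.+1 -> V, (forall i, S (v i)) /\ lin_indep v.

End Dimension.

Definition alg_center (A : nzRingType) : set A :=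
  [set z | forall a : A, z * a = a * z].
Arguments alg_center A _ : clear implicits.

Section BishopPhelpsBollobas.
Variables (R : realType) (X : completeNormedModType R[i]).

Definition unit_ball : set X := [set x | `|x| <= 1].
Definition unit_sphere : set X := [set x | `|x| = 1].

Definition dual_space : set {linear X -> R[i]^o} := [set f | continuous f].

(* The dual norm, meaningful only for f in dual_space: the supremum of an
   unbounded set is 0. *)
Definition opnorm (f : X -> R[i]) : R := sup [set normc (f x) | x in unit_ball].

Definition dual_ball : set {linear X -> R[i]^o} :=
  dual_space `&` [set f | opnorm f <= 1].
Definition dual_sphere : set {linear X -> R[i]^o} :=
  dual_space `&` [set f | opnorm f = 1].

(* The set usually denoted Pi(X). *)
Definition norming_pairs : set (X * {linear X -> R[i]^o}) :=
  [set p | [/\ unit_sphere p.1, dual_sphere p.2 & p.2 p.1 = 1]].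

Definition BPB_radii (D : set (X * {linear X -> R[i]^o})) (delta : R) : set R :=
  [set eps | 0 < eps /\
    forall x f, D (x, f) -> 1 - delta < complex.Re (f x) ->
    exists y g, [/\ norming_pairs (y, g), `|x - y| < eps%:C &
                    opnorm (fun z => f z - g z) < eps]].

Definition BPB_modulus (delta : R) : R :=
  inf (BPB_radii (unit_ball `*` dual_ball) delta).

Definition BPB_modulusS (delta : R) : R :=
  inf (BPB_radii (unit_sphere `*` dual_sphere) delta).

End BishopPhelpsBollobas.

(* Main.v *)
Require Import Defs.
From HB Require Import structures.
From mathcomp Require Import all_boot all_order all_algebra.
From mathcomp Require Import complex.
From mathcomp Require Import boolp classical_sets reals topology normedtype.
From mathcomp Require Import ring lra.
(** Upper bound, valid in every complex Banach space.  Let f have norm rho <= 1,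
    let x be in the ball with Re f x > 1 - delta, and put eps = sqrt (2 delta),
    k = (eps - 1 + rho) / 2.  Ekeland's principle on the ball gives y with
    k |x - y| <= Re f y - Re f x <= rho - 1 + delta <= k eps and
    Re f z - Re f y <= k |z - y| for z in the ball; Hahn-Banach then separates
    off h with |h| <= k such that f - h attains its norm m at y.  The pair
    (y, (f - h) / m) is norming, and |f - (f - h) / m| <= k + |m - 1| <= eps.

    Lower bound.  In an l_infinity sum the pairs (1 - s, 1), (s/2, 1 - s/2) have
    value 1 - s^2/2 but are at distance at least s from every norming pair: a
    norming pair either has first coordinate of norm one or a functional vanishing
    on the first summand.  A nontrivial center replaces the two summands by b and
    1 - b, for a central b whose spectrum lies in [0, 1] and contains 0 and 1.
    No functional calculus is needed: the only facts about b are
    |b| = |1 - b| = 1 and |b c + (1 - b) d| <= max(|c|, |d|).  The latter is proved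
    first for self-adjoint central c, d, from w^2 + b (1 - b) (c - d)^2 =
    b c^2 + (1 - b) d^2 and the inequality |u^2| <= |u^2 + v^2|; by de Casteljau's
    algorithm it bounds the Bernstein basis, binom(n, j) |b^j (1 - b)^(n - j)| <= 1,
    and expanding (w^* w)^n then yields it for arbitrary c, d. *)

Set Implicit Arguments.
Unset Strict Implicit.
Unset Printing Implicit Defensive.
Import Order.TTheory GRing.Theory Num.Theory.
Import numFieldNormedType.Exports.
Local Open Scope classical_set_scope.
Local Open Scope complex_scope.
Local Open Scope ring_scope.

(** * Hahn-Banach in cone form *)

Section HahnBanach.
Variables (R : realType) (V : lmodType R).
Implicit Types (p q : V -> R) (K : set (V * R)).

Definition sublinear p :=
  (forall u v, p (u + v) <= p u + p v) /\
  (forall t v, 0 <= t -> p (t *: v) = t * p v).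

Definition convex_cone K :=
  [/\ K (0, 0), forall u v, K u -> K v -> K (u + v) &
      forall t u, 0 <= t -> K u -> K (t *: u.1, t * u.2)].

Lemma sublinear0 p : sublinear p -> p 0 = 0.
Proof. by case=> _ pZ; rewrite -(scale0r 0) pZ// mul0r. Qed.

Lemma sublinear_ge_opp p v : sublinear p -> - p (- v) <= p v.
Proof.
move=> ps; have := sublinear0 ps; case: ps => pD _.
by rewrite -(subrr v) => p0; have := pD v (- v); rewrite p0; lra.
Qed.

(** The constraints in [K] are absorbed into the majorant: a linear h below [cone_inf K p] satisfies
    h (- w.1) <= - w.2, that is w.2 <= h w.1, for every w in [K]. *)
Definition cone_inf K p v := inf [set p (v + w.1) - w.2 | w in K].

Lemma cone_inf_sublinear K p : sublinear p -> convex_cone K ->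
    (forall w, K w -> w.2 <= p w.1) ->
  [/\ sublinear (cone_inf K p), forall v, cone_inf K p v <= p v &
      forall w, K w -> cone_inf K p (- w.1) <= - w.2].
Proof.
move=> ps [K0 KD KZ] Kp; have p0 := sublinear0 ps; have [pD pZ] := ps.
(* Finiteness: w.2 <= p w.1 <= p (v + w.1) + p (- v). *)
have lbK v : lbound [set p (v + w.1) - w.2 | w in K] (- p (- v)).
  move=> _ [w Kw <-]; have := pD (v + w.1) (- v); have := Kp _ Kw.
  by rewrite addrAC subrr add0r; lra.
have infle v w : K w -> cone_inf K p v <= p (v + w.1) - w.2.
  by move=> Kw; apply: ge_inf; [exists (- p (- v)); exact: lbK|exists w].
have leinf v c : (forall w, K w -> c <= p (v + w.1) - w.2) ->
    c <= cone_inf K p v.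
  move=> cle; apply: lb_le_inf; first by exists (p (v + 0) - 0), (0, 0).
  by move=> _ [w Kw <-]; exact: cle.
(* One inequality for all t > 0 suffices; the reverse one is the case of the inverse of t at t *:
   v. *)
have infZ t v : 0 < t -> cone_inf K p (t *: v) <= t * cone_inf K p v.
  move=> t0; rewrite mulrC -ler_pdivrMr//; apply: leinf => w Kw.
  rewrite ler_pdivrMr// (le_trans (infle _ _ (KZ t w (ltW t0) Kw)))//=.
  by rewrite -scalerDr pZ ?(ltW t0)// -mulrBr mulrC.
split=> [|v|w Kw].
- split=> [u v|t v]; last first.
    rewrite le_eqVlt => /predU1P[<-|t0].
      rewrite scale0r mul0r; apply/le_anti/andP; split.
        by have := infle 0 _ K0; rewrite /= addr0 p0 subr0.
      by apply: leinf => w Kw; rewrite add0r subr_ge0 Kp.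
    apply/le_anti/andP; split; first exact: infZ.
    rewrite -ler_pdivlMl// -{1}(scalerK (lt0r_neq0 t0) v).
    by apply: infZ; rewrite invr_gt0.
  rewrite -lerBlDr; apply: (leinf) => w Kw; rewrite lerBlDr -lerBlDl.
  apply: leinf => w' Kw'; rewrite lerBlDl.
  have := infle (u + v) _ (KD _ _ Kw Kw'); rewrite /= addrACA.
  by have := pD (u + w.1) (v + w'.1); lra.
- by have := infle v _ K0; rewrite /= addr0 subr0.
- by have := infle (- w.1) _ Kw; rewrite addNr p0 sub0r.
Qed.

(** Zorn's lemma for the reversed pointwise order. A chain is bounded by its pointwise infimum,
    which is finite because every member is at least - p (- v) at v. *)
Lemma exists_minimal_sublinear p : sublinear p ->
  exists q, [/\ sublinear q, forall v, q v <= p v &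
    forall q', sublinear q' -> (forall v, q' v <= q v) -> q' = q].
Proof.
move=> ps.
pose T := {q | sublinear q /\ forall v, q v <= p v}.
have Ts (q : T) : sublinear (sval q) by case: (svalP q).
have Tp (q : T) v : sval q v <= p v by case: (svalP q).
pose le (q1 q2 : T) := `[< forall v, sval q2 v <= sval q1 v >].
have [||||q qmin] := @Zorn T le.
- by move=> q; apply/asboolP.
- move=> q1 q2 q3 /asboolP h12 /asboolP h23; apply/asboolP => v.
  exact: le_trans (h23 v) (h12 v).
- move=> [q1 q1P] [q2 q2P] /asboolP h12 /asboolP h21; apply: eq_exist.
  by apply/funext => v; apply/le_anti; rewrite h12 h21.
- move=> C Ctot; have [->|/set0P[q0 Cq0]] := eqVneq C set0.
    by exists (exist _ p (conj ps (fun v => lexx _))).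
  pose m v := inf [set sval (q : T) v | q in C].
  have lbC v : has_lbound [set sval (q : T) v | q in C].
    exists (- p (- v)) => _ [q Cq <-].
    by rewrite (le_trans _ (sublinear_ge_opp v (Ts q)))// lerN2.
  have mle v (q : T) : C q -> m v <= sval q v by move=> Cq; apply: ge_inf => //; exists q.
  have lem v c : (forall q : T, C q -> c <= sval q v) -> c <= m v.
    move=> cle; apply: lb_le_inf; first by exists (sval q0 v), q0.
    by move=> _ [q Cq <-]; exact: cle.
  have ms : sublinear m.
    split=> [u v|t v t0].
      rewrite -lerBlDr; apply: (lem) => q1 Cq1; rewrite lerBlDr -lerBlDl.
      apply: lem => q2 Cq2; rewrite lerBlDl.
      (* The smaller of two members of the chain serves for both summands, so subadditivity passes
         to the infimum. *)
      case: (Ctot q1 q2 Cq1 Cq2) => /asboolP h.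
        by have := mle (u + v) _ Cq2; have := (Ts q2).1 u v; have := h u; lra.
      by have := mle (u + v) _ Cq1; have := (Ts q1).1 u v; have := h v; lra.
    have mZ s w : 0 < s -> m (s *: w) <= s * m w.
      move=> s0; rewrite mulrC -ler_pdivrMr//; apply: lem => q Cq.
      by rewrite ler_pdivrMr// (le_trans (mle _ _ Cq))// (Ts q).2 ?(ltW s0)// mulrC.
    move: t0; rewrite le_eqVlt => /predU1P[<-|t0].
      rewrite scale0r mul0r; apply/le_anti/andP; split.
        by rewrite (le_trans (mle _ _ Cq0))// sublinear0.
      by apply: lem => q _; rewrite sublinear0.
    apply/le_anti/andP; split; first exact: mZ.
    rewrite -ler_pdivlMl// -{1}(scalerK (lt0r_neq0 t0) v).
    by apply: mZ; rewrite invr_gt0.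
  have mp v : m v <= p v by rewrite (le_trans (mle v _ Cq0)).
  by exists (exist _ m (conj ms mp)) => q Cq; apply/asboolP => v; exact: mle.
exists (sval q); split=> // q' q's q'q.
have q'p v : q' v <= p v by exact: le_trans (q'q v) (Tp q v).
have /(congr1 sval) // : exist _ q' (conj q's q'p) = q.
by apply: qmin; apply/asboolP.
Qed.

(* A minimal sublinear functional q is odd, because cone_inf along the ray
   {(t a, t q(a))} cannot decrease it; an odd sublinear functional is linear. *)
Lemma minimal_sublinear_scalar p : sublinear p ->
  exists h : {scalar V}, forall v, h v <= p v.
Proof.
move=> /exists_minimal_sublinear[q [qs qp qmin]].
have qN a : q (- a) = - q a.
  pose K : set (V * R) := [set (t *: a, t * q a) | t in [set t | 0 <= t]].
  have Kc : convex_cone K.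
    split.
    - by exists 0; rewrite /= ?scale0r ?mul0r.
    - move=> _ _ [s s0 <-] [t t0 <-]; exists (s + t); first exact: addr_ge0.
      by rewrite scalerDl mulrDl.
    - move=> s _ s0 [t t0 <-]; exists (s * t); first exact: mulr_ge0.
      by rewrite scalerA mulrA.
  have [|ks kq ka] := cone_inf_sublinear qs Kc.
    by move=> _ [t t0 <-] /=; rewrite qs.2.
  rewrite -(qmin _ ks kq); apply/le_anti/andP; split.
    rewrite (qmin _ ks kq).
    have := ka (a, q a); rewrite /= (qmin _ ks kq); apply.
    by exists 1; rewrite /= ?scale1r ?mul1r.
  by rewrite (qmin _ ks kq); have := sublinear_ge_opp a qs; lra.
have qD u v : q (u + v) = q u + q v.
  apply/le_anti/andP; split; first exact: qs.1.
  by have := qs.1 (- u) (- v); rewrite -opprD !qN; lra.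
have qZ t v : q (t *: v) = t * q v.
  have [t0|t0] := leP 0 t; first exact: qs.2.
  by rewrite -[t in LHS]opprK scaleNr qN qs.2 ?oppr_ge0 ?ltW// mulNr opprK.
have qlin : linear_for *%R q by move=> t u v; rewrite qD qZ.
pose hl := GRing.isLinear.Build R V R *%R q qlin.
pose h : {scalar V} := HB.pack q hl.
by exists h.
Qed.

Theorem hahn_banach_cone p K : sublinear p -> convex_cone K ->
    (forall w, K w -> w.2 <= p w.1) ->
  exists2 h : {scalar V}, forall v, h v <= p v & forall w, K w -> w.2 <= h w.1.
Proof.
move=> ps Kc Kp; have [qs qp qK] := cone_inf_sublinear ps Kc Kp.
have [h hq] := minimal_sublinear_scalar qs.
exists h => [v|w Kw]; first exact: le_trans (hq v) (qp v).
by have := le_trans (hq (- w.1)) (qK _ Kw); rewrite linearN lerN2.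
Qed.

End HahnBanach.

(** * Complex functionals and the dual norm *)

Section Realification.
Variables (R : realType) (X : lmodType R[i]).

(** Restriction of scalars from [R[i]] to [R]; the alias carries the second module structure. *)
Definition realified : Type := X.
HB.instance Definition _ := GRing.Zmodule.on realified.

Let rscale (t : R) (v : realified) : realified := t%:C *: (v : X).

Let rscaleA s t v : rscale s (rscale t v) = rscale (s * t) v.
Proof. by rewrite /rscale scalerA rmorphM. Qed.
Let rscale1 : left_id 1 rscale.
Proof. by move=> v; rewrite /rscale scale1r. Qed.
Let rscaleDr : right_distributive rscale +%R.
Proof. by move=> t u v; rewrite /rscale scalerDr. Qed.
Let rscaleDl v : {morph rscale^~ v : s t / s + t}.
Proof. by move=> s t; rewrite /rscale rmorphD scalerDl. Qed.

HB.instance Definition _ := GRing.Zmodule_isLmodule.Build R realified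
  rscaleA rscale1 rscaleDr rscaleDl.

Lemma realified_scaleE (t : R) (v : realified) : t *: v = t%:C *: (v : X).
Proof. by []. Qed.

(** A complex functional is determined by its real part through F v = h v - i h (i v). *)
Lemma complexification (h : {scalar realified}) :
  exists F : {linear X -> R[i]^o}, forall v, complex.Re (F v) = h v.
Proof.
pose F (v : X) : R[i]^o := (h v +i* - h ('i *: v : X))%C.
have hZ (t : R) (v : X) : h (t%:C *: v : X) = t * h v by exact: (scalarZ h t v).
have hD (u v : X) : h (u + v : X) = h u + h v by exact: (linearD h).
have hN (u : X) : h (- u : X) = - h u by exact: (linearN h).
have Flin : linear_for *:%R F.
  move=> c u v; rewrite /F.
  have -> : h (c *: u + v : X) = complex.Re c * h u
      + complex.Im c * h ('i *: u : X) + h v.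
    rewrite [c in LHS]complexE !hD; congr (_ + _).
    by rewrite scalerDl hD hZ ['i%C * _]mulrC -scalerA hZ.
  have -> : h ('i *: (c *: u + v) : X) = complex.Re c * h ('i *: u : X)
      - complex.Im c * h u + h ('i *: v : X).
    rewrite [c in LHS]complexE scalerDr hD; congr (_ + _).
    rewrite scalerA mulrDr scalerDl hD; congr (_ + _).
      by rewrite ['i * _]mulrC -scalerA hZ.
    rewrite mulrA -expr2 sqr_i mulN1r scaleNr hN hZ//.
  apply/eqP; rewrite eq_complex; case: c => a b /=.
  by apply/andP; split; apply/eqP; ring.
pose Fl := GRing.isLinear.Build R[i] X R[i]^o *:%R F Flin.
by exists (HB.pack F Fl : {linear X -> R[i]^o}).
Qed.

End Realification.

Section RealNorm.
Variables (R : realType) (X : normedModType R[i]).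
Implicit Types x y : X.

(** The norm is valued in [R[i]]; this is the same number in [R], where the order is total and [lra]
    applies. *)
Definition rnorm x : R := complex.Re `|x|.

Lemma rnormE x : `|x| = (rnorm x)%:C.
Proof. by apply/esym/eqP; rewrite eq_complex /= eqxx /= -(ger0_Im (normr_ge0 x)). Qed.

Lemma rnorm_ge0 x : 0 <= rnorm x.
Proof. by rewrite -lecR -rnormE normr_ge0. Qed.

Lemma rnormD x y : rnorm (x + y) <= rnorm x + rnorm y.
Proof. by rewrite -lecR rmorphD /= -!rnormE ler_normD. Qed.

Lemma rnormZ (c : R[i]) x : rnorm (c *: x) = normc c * rnorm x.
Proof. by apply: complexI; rewrite -rnormE normrZ rmorphM /= -rnormE. Qed.

Lemma rnormN x : rnorm (- x) = rnorm x.
Proof. by rewrite /rnorm normrN. Qed.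

Lemma rnorm0 : rnorm 0 = 0.
Proof. by rewrite /rnorm normr0. Qed.

Lemma rnorm_eq0 x : rnorm x = 0 -> x = 0.
Proof. by move=> x0; apply/normr0_eq0; rewrite rnormE x0. Qed.

Lemma rdistC x y : rnorm (x - y) = rnorm (y - x).
Proof. by rewrite -rnormN opprB. Qed.

Lemma rdist_triangle y x z : rnorm (x - z) <= rnorm (x - y) + rnorm (y - z).
Proof. by rewrite (le_trans _ (rnormD _ _))// addrA subrK. Qed.

End RealNorm.

Section Modulus.
Variable R : realType.
Implicit Type z : R[i].

Lemma normc_ge0 z : 0 <= normc z.
Proof. by case: z => a b; exact: sqrtr_ge0. Qed.

Lemma Re_le_normc z : complex.Re z <= normc z.
Proof. by rewrite (le_trans (ler_norm _))// -lecR; exact: normc_ge_Re. Qed.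

Lemma normc_real (t : R) : normc t%:C = `|t|.
Proof. by rewrite /= expr0n addr0 sqrtr_sqr. Qed.

Lemma exists_phase z : exists2 w : R[i], normc w = 1 & w * z = (normc z)%:C.
Proof.
have [->|z0] := eqVneq z 0.
  by exists 1; rewrite ?mulr0 ?ComplexField.Normc.normc0 ?ComplexField.Normc.normc1.
have nz0 : normc z != 0 by apply: contra_neq z0; exact: ComplexField.Normc.eq0_normc.
exists ((normc z)%:C * z^-1).
  rewrite ComplexField.Normc.normcM ComplexField.Normc.normcV normc_real.
  by rewrite ger0_norm ?normc_ge0// divff.
by rewrite mulrVK ?unitfE.
Qed.

Lemma normc_le_Re z : normc z <= complex.Re z -> z = (complex.Re z)%:C.
Proof.
case: z => a b /= h; congr (_ +i* _)%C.
have a0 : 0 <= a by exact: le_trans (sqrtr_ge0 _) h.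
move: h; rewrite -(ler_pXn2r (n := 2))// ?nnegrE ?sqrtr_ge0//.
rewrite sqr_sqrtr ?addr_ge0 ?sqr_ge0// gerDl => b2.
by apply/eqP; rewrite -sqrf_eq0; apply/eqP/le_anti; rewrite b2 sqr_ge0.
Qed.

End Modulus.

Section Dual.
Variables (R : realType) (X : completeNormedModType R[i]).
Implicit Types (f : {linear X -> R[i]^o}) (x : X) (k : R).

Lemma bounded_dual_space f k :
  (forall x, normc (f x) <= k * rnorm x) -> dual_space f.
Proof.
move=> fk; apply/linear_bounded_continuous/linear_boundedP.
exists k%:C; split; first by apply/complex_realP; exists k.
move=> M kM x; apply: le_trans (ler_wpM2r (normr_ge0 x) (ltW kM)).
by rewrite (rnormE x) -rmorphM lecR fk.
Qed.

Lemma dual_space_bounded f : dual_space f ->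
  exists2 k, 0 <= k & forall x, normc (f x) <= k * rnorm x.
Proof.
move=> /linear_bounded_continuous/linear_boundedP[M [Mreal]].
have M1 : M < `|M| + 1 by rewrite ltr_pwDr// real_ler_norm.
move=> /(_ _ M1) fM.
have /complex_realP[k kE] : `|M| + 1 \is Num.real.
  by rewrite ger0_real// addr_ge0.
exists k; first by rewrite -lecR -kE addr_ge0.
by move=> x; have := fM x; rewrite kE (rnormE x) -rmorphM lecR.
Qed.

Lemma opnorm_le (F : X -> R[i]) k :
  (forall x, rnorm x <= 1 -> normc (F x) <= k) -> opnorm F <= k.
Proof.
move=> Fk; apply: ge_sup.
  by exists (normc (F 0)), 0; rewrite // /unit_ball /= normr0.
by move=> _ [x x1 <-]; apply: Fk; rewrite -lecR -rnormE.
Qed.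

Lemma le_opnorm f x : dual_space f -> normc (f x) <= opnorm f * rnorm x.
Proof.
move=> /dual_space_bounded[k k0 fk].
have le1 y : rnorm y <= 1 -> normc (f y) <= opnorm f.
  move=> y1; apply: ub_le_sup; last by exists y; rewrite // /unit_ball /= rnormE lecR.
  exists k => _ [z z1 <-]; rewrite (le_trans (fk z))// ler_piMr//.
  by rewrite -lecR -rnormE.
have [->|x0] := eqVneq x 0.
  by rewrite linear0 rnorm0 mulr0 ComplexField.Normc.normc0.
have nx : 0 < rnorm x.
  by rewrite lt_def rnorm_ge0 andbT; apply: contra_neq x0; exact: rnorm_eq0.
have nxE : normc ((rnorm x)^-1)%:C = (rnorm x)^-1.
  by rewrite normc_real ger0_norm ?invr_ge0 ?rnorm_ge0.
rewrite -ler_pdivrMr// mulrC.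
have := le1 (((rnorm x)^-1)%:C *: x).
rewrite rnormZ nxE mulVf ?gt_eqF// lexx => /(_ isT).
by rewrite linearZ ComplexField.Normc.normcM nxE.
Qed.

Lemma opnorm_ge0 f : 0 <= opnorm f.
Proof.
(* When the values of f have no supremum, [sup] is 0 by convention. *)
rewrite /opnorm; set E := [set _ | _ in _]; have [sE|/sup_out->//] := pselect (has_sup E).
apply: le_trans (ub_le_sup sE.2 (_ : E (normc (f 0)))); first exact: normc_ge0.
by exists 0; rewrite // /unit_ball /= normr0.
Qed.

(* Rotating x makes f x real and nonnegative. *)
Lemma normc_le_of_Re f k :
  (forall x, complex.Re (f x) <= k * rnorm x) ->
  forall x, normc (f x) <= k * rnorm x.
Proof.
move=> fk x; have [w w1 wE] := exists_phase (f x).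
have fwx : f (w *: x) = (normc (f x))%:C by rewrite linearZ [LHS]wE.
by have := fk (w *: x); rewrite rnormZ w1 mul1r fwx.
Qed.

End Dual.

(** * Ekeland's principle and the upper bound *)

Section UpperBound.
Variables (R : realType) (X : completeNormedModType R[i]).
Implicit Types (f : {linear X -> R[i]^o}) (x y z l : X) (k e : R).

Lemma nbhs_rball l (U : set X) : nbhs l U <->
  exists2 e, 0 < e & forall z, rnorm (l - z) < e -> U z.
Proof.
rewrite nbhs_ballP; split=> [[e /= e0 lU]|[e e0 lU]].
  have /complex_realP[t et] : e \is Num.real by rewrite ger0_real// ltW.
  exists t; first by rewrite -ltcR -et.
  by move=> z lz; apply: lU; rewrite -ball_normE /ball_ /= rnormE et ltcR.
exists e%:C; rewrite /= ?ltcR// => z.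
by rewrite -ball_normE /ball_ /= rnormE ltcR; exact: lU.
Qed.

(** The point wanted is a maximal element for the order [le]. Along a chain phi increases and is
    bounded, which controls distances: the tails form a Cauchy filter, and its limit bounds the
    chain because phi is Lipschitz. *)
Lemma ekeland (D : set X) (phi : X -> R) (M c k : R) x0 :
    closed D -> (forall u v, phi u - phi v <= M * rnorm (u - v)) ->
    (forall z, D z -> phi z <= c) -> 0 < k -> D x0 ->
  exists y, [/\ D y, k * rnorm (y - x0) <= phi y - phi x0 &
    forall z, D z -> phi z - phi y <= k * rnorm (z - y)].
Proof.
move=> Dcl phiL phic k0 Dx0.
pose le u v := k * rnorm (v - u) <= phi v - phi u.
have le_refl u : le u u by rewrite /le !subrr rnorm0 mulr0.
have le_tr v u w : le u v -> le v w -> le u w.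
  rewrite /le => uv vw.
  have := rdist_triangle v w u; rewrite -(ler_pM2l k0) mulrDr; lra.
have le_anti u v : le u v -> le v u -> u = v.
  rewrite /le rdistC => uv vu; apply/eqP; rewrite -subr_eq0; apply/eqP.
  apply: rnorm_eq0; apply/le_anti; rewrite rnorm_ge0 andbT.
  by rewrite -(ler_pM2l k0) mulr0; lra.
pose T := {z | D z /\ le x0 z}.
have TD (u : T) : D (sval u) by case: (svalP u).
have Tx (u : T) : le x0 (sval u) by case: (svalP u).
have [u //||||y ymax] := @Zorn T (fun u v => le (sval u) (sval v)).
- by move=> u v w; exact: le_tr.
- move=> [u uP] [v vP] uv vu; apply: eq_exist.
  exact: le_anti uv vu.
- move=> C Ctot; have [->|/set0P[c0 Cc0]] := eqVneq C set0.
    by exists (exist _ x0 (conj Dx0 (le_refl x0))).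
  pose F := filter_from C (fun u : T => [set sval v | v in [set v | C v /\ le (sval u) (sval v)]]).
  have FF : ProperFilter F.
    apply: filter_from_proper.
      apply: filter_from_filter; first by exists c0.
      move=> u v Cu Cv; case: (Ctot u v Cu Cv) => uv.
        exists v => // _ [w [Cw vw] <-]; split; exists w; split=> //.
        exact: le_tr uv vw.
      exists u => // _ [w [Cw vw] <-]; split; exists w; split=> //.
      exact: le_tr uv vw.
    by move=> u Cu; exists (sval u), u.
  have /cauchy_cvgP/cvg_ex[l Fl] : cauchy F.
    apply: cauchy_exP => e e0.
    have /complex_realP[t et] : e \is Num.real by rewrite ger0_real// ltW.
    have t0 : 0 < t by rewrite -ltcR -et.
    have phiC : has_sup [set phi (sval (u : T)) | u in C].
      split; first by exists (phi (sval c0)), c0.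
      by exists c => _ [u Cu <-]; exact: phic.
    (* Past a member whose phi-value is within k t of the supremum, the chain stays within distance
       t. *)
    have [_ [u Cu <-] su] := sup_adherent (mulr_gt0 k0 t0) phiC.
    exists (sval u), u => // _ [v [Cv uv] <-].
    rewrite -ball_normE /ball_ /= rnormE et ltcR rdistC -(ltr_pM2l k0).
    have /(ub_le_sup phiC.2) : [set phi (sval (u : T)) | u in C] (phi (sval v)) by exists v.
    by move: uv; rewrite /le; lra.
  have approx (u : T) e : C u -> 0 < e ->
      exists v : T, le (sval u) (sval v) /\ rnorm (l - sval v) < e.
    move=> Cu e0.
    have /Fl[v Cv vF] : nbhs l [set z | rnorm (l - z) < e].
      by apply/nbhs_rball; exists e.
    case: (Ctot u v Cu Cv) => uv; first by exists v; split=> //; apply: vF; exists v.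
    by exists u; split=> //; apply: vF; exists u.
  have lub (u : T) : C u -> le (sval u) l.
    move=> Cu; apply/ler_addgt0Pr => e e0.
    (* Replacing a chain member v by the limit costs k |l - v| in the distance and at most |M| |l -
       v| in phi. *)
    have kM : 0 < k + `|M| by rewrite ltr_pwDl.
    have [v [uv lv]] := approx u _ Cu (divr_gt0 e0 kM).
    have := phiL (sval v) l; rewrite rdistC => vl.
    have lv' : (k + `|M|) * rnorm (l - sval v) <= e.
      by rewrite mulrC -ler_pdivlMr// ltW.
    have := rdist_triangle (sval v) l (sval u); rewrite -(ler_pM2l k0) mulrDr.
    have : M * rnorm (l - sval v) <= `|M| * rnorm (l - sval v).
      by rewrite ler_wpM2r ?rnorm_ge0// ler_norm.
    by move: uv lv'; rewrite /le mulrDl; lra.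
  have Dl : D l.
    apply: Dcl => U /nbhs_rball[e e0 lU].
    have [v [_ lv]] := approx c0 e Cc0 e0.
    by exists (sval v); split; [exact: TD|exact: lU].
  exists (exist _ l (conj Dl (le_tr _ _ _ (Tx c0) (lub _ Cc0)))) => u Cu.
  exact: lub.
exists (sval y); split=> [||z Dz]; [exact: TD|exact: Tx|].
rewrite leNgt; apply/negP => yz.
have xz : le x0 z by apply: le_tr (Tx y) (ltW yz).
have zy : z = sval y by rewrite -(ymax (exist _ z (conj Dz xz)) (ltW yz)).
by move: yz; rewrite zy !subrr rnorm0 mulr0 ltxx.
Qed.

Lemma closed_rball : closed [set z : X | rnorm z <= 1].
Proof.
move=> l lB /=; apply/ler_addgt0Pr => e e0.
have /lB[z [/= z1 lz]] : nbhs l [set z | rnorm (l - z) < e].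
  by apply/nbhs_rball; exists e.
by have := rnormD (l - z) z; rewrite subrK; lra.
Qed.

Lemma bishop_phelps f x k : dual_space f -> rnorm x <= 1 -> 0 < k ->
  exists y (h : {linear X -> R[i]^o}),
    [/\ rnorm y <= 1, k * rnorm (x - y) <= complex.Re (f y) - complex.Re (f x),
        forall v, normc (h v) <= k * rnorm v &
        forall z, rnorm z <= 1 ->
          complex.Re (f z - h z) <= complex.Re (f y - h y)].
Proof.
move=> fd x1 k0; have [M M0 fM] := dual_space_bounded fd.
pose phi z := complex.Re (f z).
have phiB u v : phi (u - v) = phi u - phi v by rewrite /phi linearB raddfB.
have phiD u v : phi (u + v) = phi u + phi v by rewrite /phi linearD raddfD.
have phiZ (t : R) v : phi (t%:C *: v) = t * phi v.
  by rewrite /phi linearZ; case: (f v) => a b /=; rewrite mul0r subr0.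
have phiM v : phi v <= M * rnorm v by exact: le_trans (Re_le_normc _) (fM v).
have [||||y [y1 yx ymax]] := @ekeland [set z | rnorm z <= 1] phi M M k x closed_rball.
- by move=> u v; rewrite -phiB.
- by move=> z z1; rewrite (le_trans (phiM z))// ler_piMr.
- by [].
- by [].
pose p (v : realified X) := k * rnorm (v : X).
have ps : sublinear p.
  split=> [u v|t v t0]; rewrite /p; first by rewrite -mulrDr ler_pM2l ?rnormD.
  by rewrite realified_scaleE rnormZ normc_real ger0_norm// mulrCA.
(* [K] is the cone of feasible directions z - y of the ball, each paired with its phi-value.
   Ekeland's inequality places it under k |v|; the functional h obtained in between has norm at most
   k and dominates phi on these directions, so f - h is maximal at y. *)
pose K := [set w : realified X * R | exists t z,
  [/\ 0 <= t, rnorm z <= 1, w.1 = t%:C *: (z - y) & w.2 = t * phi (z - y)]].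
have Kc : convex_cone K.
  split.
  - by exists 0, y; rewrite subrr /= scaler0 mul0r.
  - move=> u v [s [z [s0 z1 u1 u2]]] [t [w [t0 w1 v1 v2]]].
    have [st0|st0] := eqVneq (s + t) 0.
      have {}s0 : s = 0 by lra.
      have {}t0 : t = 0 by lra.
      by exists 0, y; rewrite /= u1 u2 v1 v2 s0 t0 subrr !scale0r !mul0r !addr0.
    have st : 0 < s + t by rewrite lt_def st0 addr_ge0.
    (* Multiples of two directions add up to a multiple of the direction towards a convex
       combination q, which stays in the ball. *)
    pose q := (s / (s + t))%:C *: z + (t / (s + t))%:C *: w.
    have qE : (s + t)%:C *: (q - y) = s%:C *: (z - y) + t%:C *: (w - y).
      rewrite scalerBr scalerDr !scalerA -!rmorphM/= ![(s + t) * _]mulrC !divfK//.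
      by rewrite rmorphD scalerDl !scalerBr opprD addrACA.
    exists (s + t), q; split; first exact: ltW.
    + rewrite (le_trans (rnormD _ _))// !rnormZ !normc_real !ger0_norm ?divr_ge0 ?(ltW st)//.
      have -> : 1 = s / (s + t) + t / (s + t) by rewrite -mulrDl divff.
      by apply: lerD; rewrite ler_piMr// divr_ge0// ltW.
    + by rewrite /= u1 v1 qE.
    + by rewrite /= u2 v2 -!phiZ -phiD -qE.
  - move=> s u s0 [t [z [t0 z1 u1 u2]]]; exists (s * t), z; split=> //=.
    + exact: mulr_ge0.
    + by rewrite u1 realified_scaleE scalerA -rmorphM.
    + by rewrite u2 mulrA.
have Kp w : K w -> w.2 <= p w.1.
  move=> [t [z [t0 z1 -> ->]]].
  rewrite /p rnormZ normc_real ger0_norm// mulrCA ler_wpM2l// phiB.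
  exact: ymax.
have [h0 h0p h0K] := hahn_banach_cone ps Kc Kp.
have [h hE] := complexification h0.
exists y, h; split=> //.
- by rewrite rdistC.
- by apply: normc_le_of_Re => v; rewrite hE; exact: h0p.
- move=> z z1; have /h0K /= : K (z - y, phi (z - y)).
    by exists 1, z; rewrite /= scale1r mul1r.
  by rewrite -hE phiB linearB !raddfB /= -/(phi z) -/(phi y); lra.
Qed.

Lemma bishop_phelps_bollobas f x delta (eps := Num.sqrt (2 * delta)) :
    dual_ball f -> unit_ball x ->
    0 < delta -> delta <= 2^-1 -> 1 - delta < complex.Re (f x) ->
  exists y g, [/\ norming_pairs (y, g), rnorm (x - y) <= eps &
    opnorm (fun z => f z - g z) <= eps].
Proof.
move=> [fd f1]; rewrite /unit_ball /= rnormE lecR => x1 d0 d2 fx.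
have eps2 : eps ^+ 2 = 2 * delta by rewrite sqr_sqrtr// mulr_ge0// ltW.
have eps0 : 0 < eps by rewrite sqrtr_gt0 mulr_gt0.
have eps1 : eps <= 1 by nra.
have deps : delta <= eps by nra.
set rho := opnorm f in f1; have {}f1 : rho <= 1 by [].
have fle z : normc (f z) <= rho * rnorm z by exact: le_opnorm.
have rho0 : 0 <= rho by apply: opnorm_ge0.
have fx_rho : 1 - delta < rho.
  rewrite (lt_le_trans fx)// (le_trans (Re_le_normc _))// (le_trans (fle x))//.
  by rewrite ler_piMr.
(* This choice solves 2 k + 1 - rho = eps, which is what the last estimate |f - g| <= k + |m - 1| <=
   k + (k + 1 - rho) requires. *)
pose k := (eps - 1 + rho) / 2.
have k0 : 0 < k by rewrite /k; lra.
have [y [h [y1 yx hk ymax]]] := bishop_phelps fd x1 k0.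
pose G : {linear X -> R[i]^o} := f \- h.
have GE z : G z = f z - h z by [].
set m := complex.Re (f y - h y) in ymax.
have m0 : 0 <= m by have := ymax 0; rewrite rnorm0 -GE linear0; apply.
have Gm z : normc (G z) <= m * rnorm z.
  apply: normc_le_of_Re => {}z; have [->|z0] := eqVneq z 0.
    by rewrite linear0 rnorm0 mulr0.
  have nz : 0 < rnorm z.
    by rewrite lt_def rnorm_ge0 andbT; apply: contra_neq z0; exact: rnorm_eq0.
  rewrite -ler_pdivrMr//; have := ymax ((rnorm z)^-1%:C *: z).
  rewrite rnormZ normc_real ger0_norm ?invr_ge0 ?rnorm_ge0// mulVf ?gt_eqF// lexx.
  move=> /(_ isT); rewrite -GE linearZ mulrC; apply: le_trans.
  by case: (G z) => a b /=; rewrite mul0r subr0.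
have hE z : h z = f z - G z by rewrite GE opprB addrC subrK.
have rhoE : rho <= m + k.
  apply: opnorm_le => z z1; have := le_normcD (G z) (h z).
  rewrite GE subrK => /le_trans; apply; apply: lerD.
    by rewrite -GE (le_trans (Gm z))// ler_piMr.
  by rewrite (le_trans (hk z))// ler_piMr// ltW.
have mE : m <= rho + k.
  rewrite (le_trans (Re_le_normc _))// (le_trans (le_normcD _ _))//.
  rewrite normcN lerD// ?(le_trans (fle y))// ?(le_trans (hk y))//.
    by rewrite ler_piMr.
  by rewrite ler_piMr// ltW.
(* rho - k = (1 + rho - eps) / 2 is positive since eps <= 1 and rho > 1 - delta > 0. *)
have m_gt0 : 0 < m.
  have : 0 < rho - k by rewrite /k; lra.
  by move: rhoE; lra.
have Gy : G y = m%:C.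
  by apply: normc_le_Re; rewrite (le_trans (Gm y))// ler_piMr.
have ny : rnorm y = 1.
  apply/le_anti; rewrite y1/=; have := Gm y.
  by rewrite Gy normc_real ger0_norm// ler_pMr.
pose g : {linear X -> R[i]^o} := m^-1%:C \*: G.
have gE z : g z = m^-1%:C * G z by [].
have g1 z : normc (g z) <= 1 * rnorm z.
  rewrite gE ComplexField.Normc.normcM normc_real ger0_norm ?invr_ge0// mul1r.
  by rewrite ler_pdivrMl.
have gy : g y = 1 by rewrite gE Gy -rmorphM mulVf ?gt_eqF.
have gd : dual_space g := bounded_dual_space g1.
exists y, g; split.
- split=> //=; first by rewrite /unit_sphere /= rnormE ny.
  split=> //; apply/le_anti/andP; split.
    by apply: opnorm_le => z z1; rewrite (le_trans (g1 z)) ?mul1r.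
  have := le_opnorm y gd; rewrite gy ny mulr1.
  by rewrite ComplexField.Normc.normc1.
- rewrite -(ler_pM2l k0) (le_trans yx)//.
  have := le_trans (Re_le_normc _) (fle y).
  have := ler_piMr rho0 y1.
  (* As delta = eps^2 / 2, the difference k eps - (rho - 1 + delta) is (1 - rho) (1 - eps / 2). *)
  have : rho - (1 - delta) <= k * eps.
    have : 0 <= (1 - rho) * (1 - eps) by rewrite mulr_ge0// subr_ge0.
    by move: eps2 f1; rewrite /k expr2; lra.
  lra.
- apply: opnorm_le => z z1.
  (* Splitting off h leaves a multiple of G; since |G| <= m, the second term has norm at most |m -
     1|. *)
  have -> : f z - g z = h z + (1 - m^-1)%:C * G z.
    by rewrite hE gE rmorphB mulrBl mul1r addrA subrK.
  rewrite (le_trans (le_normcD _ _))//.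
  rewrite ComplexField.Normc.normcM normc_real.
  have hz : normc (h z) <= k by rewrite (le_trans (hk z))// ler_piMr// ltW.
  have Gz : normc (G z) <= m by rewrite (le_trans (Gm z))// ler_piMr.
  have : `|1 - m^-1| * normc (G z) <= `|m - 1|.
    rewrite (le_trans (ler_wpM2l (normr_ge0 _) Gz))//.
    by rewrite -{2}(ger0_norm m0) -normrM mulrBl mul1r mulVf ?gt_eqF.
  have : `|m - 1| <= k + 1 - rho by rewrite ler_norml; apply/andP; split; lra.
  by move: hz; rewrite /k; lra.
Qed.

Lemma gt_sqrt_BPB_radii (D : set (X * {linear X -> R[i]^o})) delta e :
    D `<=` (@unit_ball _ X) `*` (@dual_ball _ X) ->
    0 < delta -> delta <= 2^-1 -> Num.sqrt (2 * delta) < e ->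
  BPB_radii D delta e.
Proof.
move=> DB d0 d2 de; split; first exact: le_lt_trans (sqrtr_ge0 _) de.
move=> x f /DB[/= xB fB] fx.
have [y [g [yg xy fg]]] := bishop_phelps_bollobas fB xB d0 d2 fx.
exists y, g; split=> //; last exact: le_lt_trans fg de.
by rewrite rnormE ltcR (le_lt_trans xy).
Qed.

End UpperBound.

(** * Commutative real algebras with a square norm *)

Section SquareNorm.
(** [N] behaves like the norm on the self-adjoint part of a commutative C*-algebra. [Nsqr_le] stands
    in for positivity of squares, and square roots are approximated inside [B]. *)
Variables (R : realType) (B : comNzRingType) (iota : {rmorphism R -> B}).
Variable N : B -> R.
Hypothesis ND : forall x y, N (x + y) <= N x + N y.
Hypothesis NZ : forall a x, N (iota a * x) = `|a| * N x.
Hypothesis NM : forall x y, N (x * y) <= N x * N y.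
Hypothesis N1 : N 1 = 1.
Hypothesis Nsqr : forall x, N (x ^+ 2) = N x ^+ 2.
Hypothesis Nsqr_le : forall x y, N (x ^+ 2) <= N (x ^+ 2 + y ^+ 2).
Implicit Types (x y t c d : B) (e M : R).

Let N0 : N 0 = 0.
Proof. by rewrite -[0](mul0r 1) -(rmorph0 iota) NZ normr0 mul0r. Qed.

Let NN x : N (- x) = N x.
Proof. by rewrite -mulN1r -(rmorph1 iota) -rmorphN NZ normrN1 mul1r. Qed.

Let NB x y : N (x - y) <= N x + N y.
Proof. by rewrite -[N y]NN ND. Qed.

Let N_ge0 x : 0 <= N x.
Proof. by have := NB x x; rewrite subrr N0; lra. Qed.

Let Niota a : N (iota a) = `|a|.
Proof. by rewrite -[iota a]mulr1 NZ N1 mulr1. Qed.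

Let NZ2 x : N (2 * x) = 2 * N x.
Proof. by rewrite -(rmorph_nat iota 2) NZ ger0_norm. Qed.

(* With Q_0 = 0 and Q_{n+1} = (x + Q_n^2) / 2, the sequence 1 - Q_n converges to
   the square root of 1 - x; it is dominated by the case x = 1 in R. *)
Lemma approx_sqrt1 x e : N x <= 1 -> 0 < e -> exists r, N (1 - x - r ^+ 2) <= e.
Proof.
move=> x1 e0; pose h := iota 2^-1.
have h2 : 2 * h = 1 by rewrite /h -(rmorph_nat iota 2) -rmorphM mulfV ?pnatr_eq0// rmorph1.
have Nh y : N (h * y) = N y / 2 by rewrite NZ ger0_norm ?invr_ge0// mulrC.
pose Q n := iter n (fun y => h * (x + y ^+ 2)) 0.
pose q n := iter n (fun s : R => (1 + s ^+ 2) / 2) 0.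
have QS n : Q n.+1 = h * (x + Q n ^+ 2) by [].
have qS n : q n.+1 = (1 + q n ^+ 2) / 2 by [].
have q01 n : 0 <= q n <= 1.
  by elim: n => [|n /andP[? ?]]; rewrite ?lexx ?ler01// qS; apply/andP; split; nra.
have Qq n : N (Q n) <= q n.
  elim: n => [|n IH]; first by rewrite N0.
  rewrite QS qS Nh ler_pM2r ?invr_gt0// (le_trans (ND _ _))// lerD// Nsqr.
  by rewrite lerXn2r ?nnegrE// (le_trans (N_ge0 _) IH).
have dQq n : N (Q n.+1 - Q n) <= q n.+1 - q n.
  elim: n => [|n IH].
    by rewrite QS qS /= expr0n /= addr0 !subr0 Nh expr0n /= addr0; lra.
  have -> : Q n.+2 - Q n.+1 = h * ((Q n.+1 - Q n) * (Q n.+1 + Q n)).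
    rewrite (QS n.+1) {2}(QS n); ring.
  rewrite Nh (qS n.+1) {2}(qS n).
  have := NM (Q n.+1 - Q n) (Q n.+1 + Q n).
  have : N (Q n.+1 - Q n) * N (Q n.+1 + Q n) <= (q n.+1 - q n) * (q n.+1 + q n).
    by rewrite ler_pM// (le_trans (ND _ _))// lerD.
  by lra.
(* The defect of 1 - Q_n as a square root is twice the increment of Q, hence dominated by the scalar
   defect 2 (q_{n+1} - q_n) = (1 - q_n)^2. *)
have res n : N (1 - x - (1 - Q n) ^+ 2) <= (1 - q n) ^+ 2.
  have -> : 1 - x - (1 - Q n) ^+ 2 = - (2 * (Q n.+1 - Q n)).
    by rewrite mulrBr QS mulrA h2; ring.
  by rewrite NN NZ2; have := dQq n; rewrite qS; lra.
(* Otherwise 1 - q_n, which is nonnegative, would drop by at least e / 2 at every step. *)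
have [n qe] : exists n, (1 - q n) ^+ 2 <= e.
  apply: contrapT => /forallNP qe.
  have uq n : 1 - q n <= 1 - n%:R * (e / 2).
    elim: n => [|n IH]; first by rewrite mul0r.
    have /negP := qe n; rewrite -ltNge qS -[n.+1]addn1 natrD => qn.
    by move: IH; lra.
  have := archi_boundP (divr_ge0 (ler0n R 2) (ltW e0)).
  set n := Num.bound _; rewrite ltr_pdivrMr// => ne.
  by have := uq n; have := q01 n; lra.
by exists (1 - Q n); exact: le_trans (res n) qe.
Qed.

Lemma approx_sqrt x e M : N x <= M -> 0 < e -> exists r, N (iota M - x - r ^+ 2) <= e.
Proof.
move=> xM e0; have := le_trans (N_ge0 x) xM.
rewrite le_eqVlt => /predU1P[M0|M0].
  exists 0; rewrite -M0 rmorph0 expr0n /= subr0 sub0r NN.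
  by rewrite (le_trans xM)// -M0 ltW.
have [||r rP] := @approx_sqrt1 (iota M^-1 * x) (e / M).
- by rewrite NZ ger0_norm ?invr_ge0 ?(ltW M0)// ler_pdivrMl// mulr1.
- exact: divr_gt0.
exists (iota (Num.sqrt M) * r).
have -> : iota M - x - (iota (Num.sqrt M) * r) ^+ 2 =
    iota M * (1 - iota M^-1 * x - r ^+ 2).
  rewrite exprMn -rmorphXn sqr_sqrtr ?(ltW M0)//.
  by rewrite !mulrBr mulr1 (mulrA _ _ x) -rmorphM divff ?gt_eqF// rmorph1 mul1r.
by rewrite NZ gtr0_norm// mulrC -ler_pdivlMr.
Qed.

(** A self-improving bound: w(u, v)^2 + (1 - t^2) (u - v)^2 = 2 w(u^2, v^2), so the supremum K of N
    (w u v) over the unit ball satisfies K^2 <= 2 K. The crude bound 4 ensures that K is finite. *)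
Lemma norm_add_sub_le2 t c d : N t <= 1 -> N c <= 1 -> N d <= 1 ->
  N ((1 + t) * c + (1 - t) * d) <= 2.
Proof.
move=> t1 c1 d1; pose w c d := (1 + t) * c + (1 - t) * d.
pose E := [set N (w u.1 u.2) | u in [set u : B * B | N u.1 <= 1 /\ N u.2 <= 1]].
have N2 y : N y <= 1 -> N (1 + y) <= 2 by move=> ?; have := ND 1 y; rewrite N1; lra.
have supE : has_sup E.
  split; first by exists (N (w c d)), (c, d).
  exists 4 => _ [[u v] [/= u1 v1] <-]; rewrite (le_trans (ND _ _))//.
  have -> : 4 = 2 * 1 + 2 * 1 :> R by lra.
  by apply: lerD; rewrite (le_trans (NM _ _))// ler_pM// N2// NN.
have leE u v : N u <= 1 -> N v <= 1 -> N (w u v) <= sup E.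
  by move=> u1 v1; apply: (ub_le_sup supE.2); exists (u, v).
have K0 : 0 <= sup E by exact: le_trans (N_ge0 (w c d)) (leE c d c1 d1).
suff : sup E <= 2 by apply: le_trans; exact: leE.
suff : sup E ^+ 2 <= 2 * sup E by move: K0; nra.
have sup_sqrt : sup E <= Num.sqrt (2 * sup E).
  apply: ge_sup; first exact: supE.1.
  move=> _ [[u v] [/= u1 v1] <-].
  rewrite -(ler_pXn2r (n := 2)) ?nnegrE ?sqrtr_ge0// sqr_sqrtr ?mulr_ge0//.
  apply/ler_addgt0Pr => e e0.
  (* r is nearly a square root of 1 - t^2, which turns (1 - t^2) (u - v)^2 into a square; the error
     e / 4 gets multiplied by N ((u - v)^2) <= 4. *)
  have [||r rP] := @approx_sqrt1 (t ^+ 2) (e / 4).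
  - by rewrite Nsqr exprn_ile1.
  - by rewrite divr_gt0.
  rewrite -Nsqr (le_trans (Nsqr_le _ (r * (u - v))))//.
  have -> : w u v ^+ 2 + (r * (u - v)) ^+ 2 =
      2 * w (u ^+ 2) (v ^+ 2) - (1 - t ^+ 2 - r ^+ 2) * (u - v) ^+ 2.
    by rewrite /w; ring.
  rewrite (le_trans (NB _ _))// NZ2 lerD//.
    by rewrite ler_pM2l// leE// Nsqr exprn_ile1.
  have uv2 : N ((u - v) ^+ 2) <= 4.
    have uv : N (u - v) <= 2 by have := NB u v; lra.
    by rewrite Nsqr -[4]/(2 * 2)%:R natrM -expr2 lerXn2r ?nnegrE.
  rewrite (le_trans (NM _ _))// (le_trans (ler_pM _ _ rP uv2))//.
  by rewrite divfK ?pnatr_eq0.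
by rewrite -[leRHS]sqr_sqrtr ?mulr_ge0// lerXn2r ?nnegrE ?sqrtr_ge0.
Qed.

(** De Casteljau's algorithm at (1 + t) / 2 for the Bernstein coefficients c, scaled by 2^n to avoid
    halves. *)
Fixpoint casteljau t n (c : nat -> B) : B :=
  if n is n'.+1 then
    (1 + t) * casteljau t n' (fun j => c j.+1) + (1 - t) * casteljau t n' c
  else c 0%N.

Lemma casteljau_le t n (c : nat -> B) : N t <= 1 -> (forall j, N (c j) <= 1) ->
  N (casteljau t n c) <= 2 ^+ n.
Proof.
move=> t1; elim: n c => [|n IH] c c1; first exact: c1.
have p0 : 0 < (2 : R) ^+ n by rewrite exprn_gt0.
pose s := iota (2 ^+ n)^-1.
have Ns y : N y <= 2 ^+ n -> N (s * y) <= 1.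
  by move=> y2; rewrite NZ gtr0_norm ?invr_gt0// ler_pdivrMl// mulr1.
have := norm_add_sub_le2 t1 (Ns _ (IH (fun j => c j.+1) (fun j => c1 j.+1)))
  (Ns _ (IH c c1)).
have -> : (1 + t) * (s * casteljau t n (fun j => c j.+1)) +
    (1 - t) * (s * casteljau t n c) = s * casteljau t n.+1 c by rewrite /=; ring.
by rewrite NZ gtr0_norm ?invr_gt0// ler_pdivrMl// exprS mulrC.
Qed.

Lemma casteljau_basis t n k : casteljau t n (fun j => (j == k)%:R) =
  'C(n, k)%:R * ((1 + t) ^+ k * (1 - t) ^+ (n - k)).
Proof.
have cast0 m : casteljau t m (fun=> 0) = 0.
  by elim: m => //= m ->; rewrite !mulr0 addr0.
elim: n k => [|n IH] [|k] //=.
- by rewrite bin0 !expr0 !mulr1.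
- by rewrite bin0n mul0r.
- rewrite cast0 IH !bin0 subn0 expr0; rewrite !mul1r mulr0 add0r subn0 -exprS//.
rewrite !IH /= subSS binS natrD.
(* For k >= n the coefficient ['C(n, k.+1)] vanishes; for k < n the truncated n - k is the successor
   of n - k.+1. *)
have [kn|nk] := ltnP k n; last by rewrite (@bin_small n k.+1)// mulr0n exprS; ring.
by rewrite -(subnSK kn) !exprS; ring.
Qed.

Lemma norm_bernstein_le t n k : N t <= 1 ->
  'C(n, k)%:R * N ((1 + t) ^+ k * (1 - t) ^+ (n - k)) <= 2 ^+ n.
Proof.
move=> t1; have -> : 'C(n, k)%:R * N ((1 + t) ^+ k * (1 - t) ^+ (n - k)) =
    N (casteljau t n (fun j => (j == k)%:R)).
  by rewrite casteljau_basis -(rmorph_nat iota 'C(n, k)) NZ ger0_norm.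
by apply: casteljau_le => // j; case: eqP; rewrite ?N1 ?N0.
Qed.

Lemma norm_sqr_sub_le x y : N (x ^+ 2 - y ^+ 2) <= N (x ^+ 2 + y ^+ 2).
Proof.
rewrite -(ler_pXn2r (n := 2)) ?nnegrE// -!Nsqr.
have -> : (x ^+ 2 + y ^+ 2) ^+ 2 = (x ^+ 2 - y ^+ 2) ^+ 2 + (2 * x * y) ^+ 2 by ring.
exact: Nsqr_le.
Qed.

(** With y^2 close to M - x^2, the element is close to x^2 - y^2, whose norm is at most that of x^2
    + y^2, which is close to M. *)
Lemma norm_double_sqr_sub_le x M : N (x ^+ 2) <= M -> N (2 * x ^+ 2 - iota M) <= M.
Proof.
move=> xM; apply/ler_addgt0Pr => e e0.
have [//||y yP] := @approx_sqrt (x ^+ 2) (e / 2) M; first by rewrite divr_gt0.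
have M0 : 0 <= M by exact: le_trans xM.
have -> : 2 * x ^+ 2 - iota M = x ^+ 2 - y ^+ 2 - (iota M - x ^+ 2 - y ^+ 2) by ring.
have := NB (x ^+ 2 - y ^+ 2) (iota M - x ^+ 2 - y ^+ 2).
have := norm_sqr_sub_le x y.
have -> : x ^+ 2 + y ^+ 2 = iota M - (iota M - x ^+ 2 - y ^+ 2) by ring.
have := NB (iota M) (iota M - x ^+ 2 - y ^+ 2); rewrite Niota ger0_norm//.
lra.
Qed.

(* 1 + t is nonnegative, so its spectrum lies in [0, N (1 + t)]. *)
Lemma norm_double_sub_norm_le t : N t <= 1 ->
  N (2 * (1 + t) - iota (N (1 + t))) <= N (1 + t).
Proof.
move=> t1; set M := N (1 + t); apply/ler_addgt0Pr => e e0.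
(* r^2 approximates 1 + t. Of the four quarters of e, one enlarges M, two come from the doubled
   residual, one from returning to M. *)
have [||r rP] := @approx_sqrt1 (- t) (e / 4); [by rewrite NN|by rewrite divr_gt0|].
rewrite opprK in rP.
have rM : N (r ^+ 2) <= M + e / 4.
  have := NB (1 + t) (1 + t - r ^+ 2); rewrite subKr -/M; lra.
have := norm_double_sqr_sub_le rM.
have := ND (2 * r ^+ 2 - iota (M + e / 4)) (2 * (1 + t - r ^+ 2) + iota (e / 4)).
have := ND (2 * (1 + t - r ^+ 2)) (iota (e / 4)).
rewrite NZ2 Niota (ger0_norm (divr_ge0 (ltW e0) _))//.
have -> : 2 * r ^+ 2 - iota (M + e / 4) + (2 * (1 + t - r ^+ 2) + iota (e / 4)) =
  2 * (1 + t) - iota M by rewrite rmorphD; ring.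
by lra.
Qed.

(** The affine map from t to s fixes -1 and moves the top of the spectrum, N (1 + t) - 1, to 1. *)
Lemma exists_norm_add1_eq2 t : N t <= 1 -> 1 + t != 0 ->
    (forall x, N x = 0 -> x = 0) ->
  let s := iota (2 / N (1 + t)) * (1 + t) - 1 in N s <= 1 /\ N (1 + s) = 2.
Proof.
move=> t1 t0 N_eq0 s; have M0 : 0 < N (1 + t).
  by rewrite lt_def N_ge0 andbT; apply: contra_neq t0; exact: N_eq0.
have sE : iota (N (1 + t))^-1 * (2 * (1 + t) - iota (N (1 + t))) = s.
  rewrite /s mulrBr -rmorphM mulVf ?gt_eqF// rmorph1 mulrA; congr (_ * _ - _).
  by rewrite -[X in _ * X](rmorph_nat iota) -rmorphM mulrC.
split.
  by rewrite -sE NZ gtr0_norm ?invr_gt0// ler_pdivrMl// mulr1 norm_double_sub_norm_le.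
by rewrite addrC subrK NZ gtr0_norm ?divr_gt0// divfK ?gt_eqF.
Qed.

(* An affine image of h whose spectrum has minimum -1 and maximum 1. *)
Lemma exists_spread (h : B) : (forall x, N x = 0 -> x = 0) ->
    (forall a, h != iota a) ->
  exists t, [/\ N t <= 1, N (1 + t) = 2 & N (1 - t) = 2].
Proof.
move=> N_eq0 hne.
have h0 : 0 < N h.
  rewrite lt_def N_ge0 andbT; apply: contra_neq (hne 0) => /N_eq0 ->.
  by rewrite rmorph0.
pose t0 := iota (N h)^-1 * h.
have hE : iota (N h) * t0 = h by rewrite mulrA -rmorphM divff ?gt_eqF// rmorph1 mul1r.
have t01 : N t0 <= 1 by rewrite NZ gtr0_norm ?invr_gt0// mulVf// gt_eqF.
have t0ne a : t0 != iota a.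
  apply: contra_neq (hne (N h * a)) => t0a.
  by rewrite rmorphM -t0a hE.
have nz0 : 1 + t0 != 0.
  apply: contra_neq (t0ne (-1)) => /eqP.
  by rewrite addrC addr_eq0 rmorphN1 => /eqP.
have [] := exists_norm_add1_eq2 t01 nz0 N_eq0.
set t1 := _ - 1 => t11 t12.
(* t1 has spectral maximum 1. Were it equal to 1, t0 would be scalar; so - t1 can be stretched in
   turn. *)
have nz1 : 1 - t1 != 0.
  apply: contra_neq (t0ne (N (1 + t0) - 1)) => /eqP; rewrite subr_eq0 => /eqP t1E.
  have M0 : 0 < N (1 + t0).
    by rewrite lt_def N_ge0 andbT; apply: contra_neq nz0; exact: N_eq0.
  have : iota (N (1 + t0) / 2) * (t1 + 1) = 1 + t0.
    rewrite /t1 subrK mulrA -[RHS]mul1r -rmorphM; congr (_ * _).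
    by rewrite mulrA divfK ?pnatr_eq0// divff ?gt_eqF// rmorph1.
  rewrite -t1E -[1 + 1](rmorph_nat iota 2) -rmorphM divfK ?pnatr_eq0// rmorphB rmorph1 => ->.
  by rewrite addrC addKr.
have t1N : N (- t1) <= 1 by rewrite NN.
have [] := exists_norm_add1_eq2 t1N nz1 N_eq0.
set t2 := _ - 1; set M := N (1 - t1) => t21 t22.
exists t2; split=> //; apply/le_anti/andP; split.
  by have := NB 1 t2; rewrite N1; lra.
have M0 : 0 < M.
  by rewrite lt_def N_ge0 andbT; apply: contra_neq nz1; exact: N_eq0.
have M2 : M <= 2 by have := NB 1 t1; rewrite N1 -/M; lra.
(* The second stretching keeps the other end: N (1 + t1) = 2 gives N (1 - t2) >= (2 / M) (2 - (2 -
   M)) = 2. *)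
have -> : 1 - t2 = iota (2 / M) * (1 + t1 - iota (2 - M)).
  rewrite /t2 rmorphB rmorph_nat.
  have : iota (2 / M) * iota M = 2 by rewrite -rmorphM divfK ?gt_eqF// rmorph_nat.
  set a := iota (2 / M); set b := iota M => ab.
  have -> : a * (1 + t1 - (2 - b)) = a * b - a * (1 - t1) by ring.
  by rewrite ab; ring.
rewrite NZ gtr0_norm ?divr_gt0// mulrAC ler_pdivlMr// ler_pM2l//.
have := ND (1 + t1 - iota (2 - M)) (iota (2 - M)).
by rewrite subrK t12 Niota ger0_norm ?subr_ge0//; lra.
Qed.

End SquareNorm.

(** * The self-adjoint center *)

Section CNorm.
Variables (R : realType) (A : preCStarAlgType R).
Implicit Types x y z : A.

Lemma cnorm0 : cnorm (0 : A) = 0.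
Proof. by rewrite -(scale0r (0 : A)) cnormZ ComplexField.Normc.normc0 mul0r. Qed.

Lemma cnormN x : cnorm (- x) = cnorm x.
Proof. by rewrite -scaleN1r cnormZ normcN ComplexField.Normc.normc1 mul1r. Qed.

Lemma cnormB x y : cnorm (x - y) <= cnorm x + cnorm y.
Proof. by rewrite -[cnorm y]cnormN cnormD. Qed.

Lemma cnorm_ge0 x : 0 <= cnorm x.
Proof. by have := cnormB x x; rewrite subrr cnorm0; lra. Qed.

Lemma cnormZr (a : R) x : cnorm (a%:C *: x) = `|a| * cnorm x.
Proof. by rewrite cnormZ normc_real. Qed.

Lemma star1 : star (1 : A) = 1.
Proof. by have := starK (1 : A); rewrite -{1}[star 1]mulr1 starM starK mulr1. Qed.

Lemma starN x : star (- x) = - star x.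
Proof. by rewrite -scaleN1r starZ rmorphN1 scaleN1r. Qed.

Lemma star_realZ (a : R) x : star (a%:C *: x) = a%:C *: star x.
Proof. by rewrite starZ; congr (_ *: _); apply/conj_Creal/complex_realP; exists a. Qed.

Lemma cnorm1 : cnorm (1 : A) = 1.
Proof.
have := cnorm_star_mul (1 : A); rewrite star1 mul1r expr2 => n1.
have n0 : cnorm (1 : A) != 0.
  by apply/eqP => /cnorm0_eq0/eqP; rewrite oner_eq0.
by apply: (mulfI n0); rewrite mulr1.
Qed.

Lemma cnorm_star x : cnorm (star x) = cnorm x.
Proof.
have le_star z : cnorm z <= cnorm (star z).
  have [z0|z0] := eqVneq (cnorm z) 0; first by rewrite z0 cnorm_ge0.
  rewrite -(@ler_pM2r _ (cnorm z)) ?lt_def ?z0 ?cnorm_ge0//.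
  by rewrite -expr2 -cnorm_star_mul cnormM.
by apply/le_anti; rewrite le_star -{2}[x]starK le_star.
Qed.

Lemma cnorm_sum n (F : 'I_n -> A) : cnorm (\sum_i F i) <= \sum_i cnorm (F i).
Proof.
elim/big_ind2 : _ => [|x1 y1 x2 y2 h1 h2|//]; first by rewrite cnorm0.
by rewrite (le_trans (cnormD _ _))// lerD.
Qed.

Lemma cnormX_le1 x n : cnorm x <= 1 -> cnorm (x ^+ n) <= 1.
Proof.
move=> x1; elim: n => [|n IH]; first by rewrite expr0 cnorm1.
rewrite exprS (le_trans (cnormM _ _))// -[leRHS]mulr1.
by apply: ler_pM; rewrite ?cnorm_ge0.
Qed.

(** Each use of the C*-identity doubles the exponent, hence powers of two. *)
Lemma selfadjoint_cnormX x k : star x = x -> cnorm (x ^+ (2 ^ k)) = cnorm x ^+ (2 ^ k).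
Proof.
have starX z n : star z = z -> star (z ^+ n) = z ^+ n.
  by move=> zs; elim: n => [|n IH]; rewrite ?expr0 ?star1// [in LHS]exprS starM IH zs -exprSr.
move=> xs; elim: k => [|k IH]; first by rewrite expn0 !expr1.
rewrite expnSr !exprM -IH -cnorm_star_mul starX//.
Qed.

End CNorm.

Section SelfAdjointCenter.
Variables (R : realType) (A : preCStarAlgType R).

Definition sa_central : {pred A} :=
  [pred x | `[< alg_center A x /\ star x = x >]].

Lemma sa_centralP x : reflect (alg_center A x /\ star x = x) (x \in sa_central).
Proof. by rewrite inE; exact: asboolP. Qed.

Lemma sa_central_subring : subring_closed sa_central.
Proof.
split=> [|x y /sa_centralP[xc xs] /sa_centralP[yc ys]
         |x y /sa_centralP[xc xs] /sa_centralP[yc ys]]; apply/sa_centralP; split.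
- by move=> a; rewrite mul1r mulr1.
- exact: star1.
- by move=> a; rewrite mulrBl mulrBr xc yc.
- by rewrite starD starN xs ys.
- by move=> a; rewrite -mulrA yc mulrA xc mulrA.
- by rewrite starM xs ys yc.
Qed.

HB.instance Definition _ := GRing.isSubringClosed.Build A sa_central
  sa_central_subring.

(** The commutative ring to which the results on square norms are applied. *)
Record sacenter := SACenter { sacval :> A; _ : sacval \in sa_central }.

HB.instance Definition _ := [isSub for sacval].
HB.instance Definition _ := [Choice of sacenter by <:].
HB.instance Definition _ := [SubChoice_isSubNzRing of sacenter by <:].

Lemma sacenter_central (x : sacenter) (a : A) : (x : A) * a = a * (x : A).
Proof. by case: x => x /= /sa_centralP[]. Qed.

Lemma sacenter_star (x : sacenter) : star (x : A) = x.
Proof. by case: x => x /= /sa_centralP[]. Qed.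

Let sacenter_mulC : commutative (@GRing.mul sacenter).
Proof. by move=> x y; apply: val_inj; rewrite /= sacenter_central. Qed.

HB.instance Definition _ := GRing.PzRing_hasCommutativeMul.Build sacenter
  sacenter_mulC.

Lemma real_sa_central (a : R) : a%:C *: 1 \in sa_central.
Proof.
apply/sa_centralP; split; last by rewrite star_realZ star1.
by move=> x; rewrite -scalerAl -scalerAr mul1r mulr1.
Qed.

Definition sareal (a : R) : sacenter := SACenter (real_sa_central a).

Let sareal_additive : additive sareal.
Proof. by move=> a b; apply: val_inj; rewrite /= rmorphB scalerBl. Qed.

Let sareal_multiplicative : multiplicative sareal.
Proof.
split=> [a b|]; apply: val_inj; rewrite /= ?scale1r//.
by rewrite -scalerAl mul1r scalerA rmorphM.
Qed.

HB.instance Definition _ := GRing.isAdditive.Build R sacenter sareal sareal_additive.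
HB.instance Definition _ := GRing.isMultiplicative.Build R sacenter sareal
  sareal_multiplicative.

Definition sanorm (x : sacenter) : R := cnorm (x : A).

Lemma sanormD x y : sanorm (x + y) <= sanorm x + sanorm y.
Proof. exact: cnormD. Qed.

Lemma sanormZ a x : sanorm (sareal a * x) = `|a| * sanorm x.
Proof. by rewrite /sanorm /= -scalerAl mul1r cnormZr. Qed.

Lemma sanormM x y : sanorm (x * y) <= sanorm x * sanorm y.
Proof. exact: cnormM. Qed.

Lemma sanorm1 : sanorm 1 = 1.
Proof. exact: cnorm1. Qed.

Lemma sanorm_sqr x : sanorm (x ^+ 2) = sanorm x ^+ 2.
Proof. by rewrite /sanorm -cnorm_star_mul sacenter_star. Qed.

Lemma sanorm_eq0 x : sanorm x = 0 -> x = 0.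
Proof. by move=> x0; apply: val_inj; exact: cnorm0_eq0. Qed.

(* x^2 + y^2 = z^* z for z = x + i y, and x is the real part of z. *)
Lemma sanorm_sqr_le x y : sanorm (x ^+ 2) <= sanorm (x ^+ 2 + y ^+ 2).
Proof.
pose z : A := (x : A) + 'i *: (y : A).
have zs : star z = (x : A) - 'i *: (y : A).
  by rewrite starD starZ !sacenter_star conjCi scaleNr.
have -> : sanorm (x ^+ 2 + y ^+ 2) = cnorm z ^+ 2.
  rewrite -cnorm_star_mul zs /sanorm /z; congr cnorm.
  rewrite mulrBl !mulrDr -!scalerAl -!scalerAr scalerA -(expr2 'i) sqrCi scaleN1r.
  by rewrite (sacenter_central y x) opprD opprK addrA addrK -!expr2.
rewrite sanorm_sqr lerXn2r ?nnegrE ?cnorm_ge0//.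
have : cnorm (z + star z) <= 2 * cnorm z.
  by rewrite (le_trans (cnormD _ _))// cnorm_star; lra.
rewrite zs /z addrACA subrr addr0 -mulr2n -scaler_nat.
rewrite -(rmorph_nat (real_complex R)) cnormZr ger0_norm// ler_pM2l//.
Qed.

Lemma exists_nonreal_sacenter : dim_gt 1 (alg_center A) ->
  exists h : sacenter, forall a, h != sareal a.
Proof.
move=> [v [vc vfree]]; apply: contrapT => /forallNP hreal.
have hE h : exists a, h = sareal a.
  by have /existsNP[a /negP/negPn/eqP ->] := hreal h; exists a.
have is_scal z : alg_center A z -> exists c : R[i], z = c *: 1.
  move=> zc.
  have zsc a : star z * a = a * star z by rewrite -[a]starK -!starM zc.
  have h1 : z + star z \in sa_central.
    apply/sa_centralP; split; last by rewrite starD starK addrC.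
    by move=> a; rewrite mulrDl mulrDr zc zsc.
  have h2 : 'i *: (z - star z) \in sa_central.
    apply/sa_centralP; split; last first.
      by rewrite starZ starD starN starK conjCi scaleNr -scalerN opprB.
    by move=> a; rewrite -scalerAl -scalerAr mulrBl mulrBr zc zsc.
  have [a /(congr1 sacval)/= az] := hE (SACenter h1).
  have [b /(congr1 sacval)/= bz] := hE (SACenter h2).
  exists (2^-1 * (a%:C - 'i * b%:C)).
  rewrite -scalerA scalerBl -scalerA -az -bz scalerA -(expr2 'i) sqrCi scaleN1r opprK.
  rewrite addrACA subrr addr0 -mulr2n -(scaler_nat 2 z) scalerA.
  by rewrite mulVf ?pnatr_eq0// scale1r.
have [c cE] := is_scal _ (vc ord0); have [d dE] := is_scal _ (vc ord_max).
have key x y : x * c + y * d = 0 -> x = 0 /\ y = 0.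
  move=> xy; have := vfree (fun i => if i == ord0 then x else y).
  rewrite big_ord_recl big_ord1 /= (_ : lift ord0 ord0 = ord_max) ?cE ?dE; last exact: val_inj.
  rewrite !scalerA -scalerDl xy scale0r => /(_ erefl) h.
  by split; [have := h ord0|have := h ord_max].
have [|d0 _] := key d (- c); first by rewrite mulNr mulrC subrr.
have [|_ /eqP] := key 0 1; first by rewrite d0 mul0r mulr0 addr0.
by rewrite oner_eq0.
Qed.

End SelfAdjointCenter.

(** * Central convex combinations of arbitrary elements *)

Section CentralConvexity.
Variables (R : realType) (A : preCStarAlgType R).
Implicit Types (t : sacenter A) (p q c d x : A).

Lemma sacvalX t n : sacval (t ^+ n) = (t : A) ^+ n.
Proof. by elim: n => // n IH; rewrite !exprS /= IH. Qed.

Lemma cnorm_bernstein_le t n k : sanorm t <= 1 ->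
  'C(n, k)%:R * cnorm ((1 + (t : A)) ^+ k * (1 - (t : A)) ^+ (n - k)) <= 2 ^+ n.
Proof.
move=> t1; have := norm_bernstein_le (@sanormD R A) (@sanormZ R A)
  (@sanormM R A) (@sanorm1 R A) (@sanorm_sqr R A) (@sanorm_sqr_le R A) n k t1.
by rewrite /sanorm /= !sacvalX.
Qed.

(** The shape of a product of n factors p c + q d with p, q central and c, d in the unit ball: W j
    collects the words with j letters taken from the c's. *)
Definition binomial_form p q n x := exists W : nat -> A,
  (forall j, cnorm (W j) <= 'C(n, j)%:R) /\
  x = \sum_(j < n.+1) p ^+ j * q ^+ (n - j) * W j.

Lemma binomial_form1 p q : binomial_form p q 0 1.
Proof.
exists (fun j => (j == 0)%:R); split=> [[|j]|]; rewrite ?cnorm1 ?cnorm0//.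
by rewrite big_ord1 !expr0 !mulr1.
Qed.

(** The new coefficients are c W_{j-1} + d W_j, and Pascal's rule preserves the bound. *)
Lemma binomial_formM p q n c d x :
    alg_center A p -> alg_center A q -> cnorm c <= 1 -> cnorm d <= 1 ->
  binomial_form p q n x -> binomial_form p q n.+1 ((p * c + q * d) * x).
Proof.
move=> pc qc c1 d1 [W [WC ->]].
have centralX z m a : alg_center A z -> z ^+ m * a = a * z ^+ m.
  by move=> zc; elim: m => [|m IH]; rewrite ?expr0 ?mul1r ?mulr1// exprS -mulrA IH mulrA zc -mulrA.
pose W' j := (if j is j'.+1 then c * W j' else 0) + d * W j.
have WM e j : cnorm e <= 1 -> cnorm (e * W j) <= 'C(n, j)%:R.
  move=> e1; rewrite (le_trans (cnormM _ _))// -[leRHS]mul1r.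
  by apply: ler_pM; rewrite ?cnorm_ge0.
exists W'; split=> [[|j]|].
- by rewrite /W' add0r bin0 (le_trans (WM d 0 d1))// bin0.
- by rewrite /W' binS natrD addrC (le_trans (cnormD _ _))// lerD// WM.
have comm j e : p ^+ j * q ^+ (n - j) * e = e * (p ^+ j * q ^+ (n - j)).
  by rewrite -mulrA (centralX q)// [in LHS]mulrA (centralX p)// -mulrA.
under [RHS]eq_bigr do rewrite /W' mulrDr.
rewrite big_split /= [in RHS]addrC [in X in _ = X + _]big_ord_recr.
rewrite [in X in _ = _ + X]big_ord_recl /= mulr0 add0r.
(* The bound by ['C(n, n.+1)], which is 0, removes the extra top term. *)
have Wn : W n.+1 = 0.
  apply/cnorm0_eq0/le_anti; rewrite cnorm_ge0 andbT.
  by rewrite (le_trans (WC _))// bin_small.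
rewrite Wn !mulr0 addr0 mulrDl addrC !mulr_sumr; congr (_ + _); apply: eq_bigr => j _.
- rewrite /= subSn -1?ltnS// exprS.
  have -> : p ^+ j * (q * q ^+ (n - j)) = q * (p ^+ j * q ^+ (n - j)).
    by rewrite mulrA (centralX p)// -mulrA.
  move: (comm j d); move: (p ^+ j * q ^+ (n - j)) => P Pd.
  by rewrite -!mulrA; congr (_ * _); rewrite !mulrA Pd.
- rewrite /bump /= add1n subSS exprS -(mulrA p (p ^+ j)).
  move: (comm j c); move: (p ^+ j * q ^+ (n - j)) => P Pc.
  by rewrite -!mulrA; congr (_ * _); rewrite !mulrA Pc.
Qed.

Lemma binomial_form_le t n x : sanorm t <= 1 ->
  binomial_form (1 + (t : A)) (1 - (t : A)) n x -> cnorm x <= n.+1%:R * 2 ^+ n.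
Proof.
move=> t1 [W [WC ->]]; rewrite (le_trans (cnorm_sum _))//.
rewrite -[n.+1 in leRHS]card_ord -mulr_natl -[leRHS]mulrA mul1r mulr_natl -sumr_const.
apply: ler_sum => j _; apply: le_trans (cnorm_bernstein_le n j t1).
by rewrite (le_trans (cnormM _ _))// mulrC ler_wpM2r ?cnorm_ge0.
Qed.

(** With y = 1 + a and n = 2^k, squaring Bernoulli's inequality gives y^(2n) >= (1 + n a)^2, which
    exceeds 2n + 1 once n a^2 > 2. *)
Lemma le1_of_exprn_le (y : R) : 0 <= y ->
  (forall k, y ^+ (2 ^ k).*2 <= (2 ^ k).*2.+1%:R) -> y <= 1.
Proof.
move=> y0 yk; rewrite leNgt; apply/negP => y1.
pose a := y - 1; have a0 : 0 < a by rewrite subr_gt0.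
have bern n : 1 + n%:R * a <= y ^+ n.
  elim: n => [|n IH]; first by rewrite mul0r addr0.
  rewrite exprS -natr1.
  have : y * (1 + n%:R * a) <= y * y ^+ n by rewrite ler_wpM2l.
  have : 0 <= n%:R * a * a by rewrite !mulr_ge0// ltW.
  by rewrite /a; lra.
have := archi_boundP (divr_ge0 (ler0n R 2) (ltW (mulr_gt0 a0 a0))).
set k := Num.bound _; rewrite ltr_pdivrMr ?mulr_gt0// => ka.
have kn : k%:R <= (2 ^ k)%:R :> R by rewrite ler_nat ltnW// ltn_expl.
have := yk k; rewrite -[(2 ^ k).*2]addnn exprD -natr1 natrD.
set n := (2 ^ k)%N in kn *.
have n0 : 0 < n%:R :> R by rewrite ltr0n expn_gt0.
have := bern n; set z := y ^+ n => bz.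
have : (1 + n%:R * a) * (1 + n%:R * a) <= z * z.
  by apply: ler_pM => //; rewrite addr_ge0// mulr_ge0// ltW.
have na : 2 < n%:R * (a * a) by apply: lt_le_trans ka _; rewrite ler_wpM2r// mulr_ge0// ltW.
have : n%:R * 2 < n%:R * (n%:R * (a * a)) by rewrite ltr_pM2l.
have : 0 < n%:R * a by rewrite mulr_gt0.
by lra.
Qed.

(* Expand (w^* w)^m with 2m = 2^(k+1) factors, apply the Bernstein bound to each
   term and let k go to infinity. *)
Lemma cnorm_central_convex t c d : sanorm t <= 1 -> cnorm c <= 1 -> cnorm d <= 1 ->
  cnorm ((1 + (t : A)) * c + (1 - (t : A)) * d) <= 2.
Proof.
move=> t1 c1 d1; set p := 1 + _; set q := 1 - _; set w := _ + _.
have pc : alg_center A p by move=> a; rewrite mulrDl mulrDr mul1r mulr1 sacenter_central.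
have qc : alg_center A q by move=> a; rewrite mulrBl mulrBr mul1r mulr1 sacenter_central.
have wsE : star w = p * star c + q * star d.
  by rewrite starD !starM !(starD, starN) star1 sacenter_star pc qc.
have form m : binomial_form p q m.*2 ((star w * w) ^+ m).
  elim: m => [|m IH]; first exact: binomial_form1.
  rewrite exprS -mulrA doubleS {1}wsE.
  by apply: binomial_formM; rewrite ?cnorm_star//; apply: binomial_formM.
suff : cnorm w / 2 <= 1 by rewrite ler_pdivrMr// mul1r.
apply: le1_of_exprn_le; first by rewrite divr_ge0// cnorm_ge0.
move=> k; have := binomial_form_le t1 (form (2 ^ k)%N).
rewrite selfadjoint_cnormX; last by rewrite starM starK.
rewrite cnorm_star_mul -exprM mul2n expr_div_n => ?.
by rewrite ler_pdivrMr// exprn_gt0.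
Qed.

Lemma exists_central_spread : dim_gt 1 (alg_center A) ->
  exists t, [/\ sanorm t <= 1, sanorm (1 + t) = 2 & sanorm (1 - t) = 2].
Proof.
move=> /exists_nonreal_sacenter[h hne].
exact: (exists_spread (@sanormD R A) (@sanormZ R A) (@sanormM R A)
  (@sanorm1 R A) (@sanorm_sqr R A) (@sanorm_sqr_le R A) (@sanorm_eq0 R A) hne).
Qed.

End CentralConvexity.

(** * The lower bound *)

Section LowerBound.
Variable R : realType.

(** Hahn-Banach along the ray of pairs (a v, a) forces Re f v >= 1, and |f v| <= 1 then forces f v =
    1. *)
Lemma exists_norming_functional (X : completeNormedModType R[i]) (v : X) :
  rnorm v = 1 -> exists2 f : {linear X -> R[i]^o},
    forall x, normc (f x) <= rnorm x & f v = 1.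
Proof.
move=> v1; pose p (x : realified X) := rnorm (x : X).
have ps : sublinear p.
  split=> [x y|a x a0]; first exact: rnormD.
  by rewrite /p realified_scaleE rnormZ normc_real ger0_norm.
pose K : set (realified X * R) := [set (a *: (v : realified X), a) | a in [set a | 0 <= a]].
have Kc : convex_cone K.
  split.
  - by exists 0; rewrite /= ?scale0r.
  - move=> _ _ [a a0 <-] [b b0 <-]; exists (a + b); first exact: addr_ge0.
    by rewrite scalerDl.
  - move=> a _ a0 [b b0 <-]; exists (a * b); first exact: mulr_ge0.
    by rewrite scalerA.
have [|h hp hK] := hahn_banach_cone ps Kc.
  by move=> _ [a a0 <-]; rewrite /= (ps.2 _ _ a0) /p v1 mulr1.
have [f fh] := complexification h.
have f1 x : normc (f x) <= rnorm x.
  rewrite -[leRHS]mul1r; apply: normc_le_of_Re => {}x.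
  by rewrite fh mul1r; exact: hp.
exists f => //.
have fv : 1 <= complex.Re (f v).
  rewrite fh; have := hK (v, 1); apply; exists 1; rewrite ?scale1r //=.
have fvE : f v = (complex.Re (f v))%:C.
  by apply: normc_le_Re; rewrite (le_trans (f1 v))// v1.
rewrite fvE; congr (_%:C); apply/le_anti; rewrite fv andbT.
by rewrite (le_trans (Re_le_normc _))// (le_trans (f1 v))// v1.
Qed.

Lemma normc_le_of_phases (z : R[i]) (k : R) :
  (forall w, normc w = 1 -> normc (1 + w * z) <= 1 + k) -> normc z <= k.
Proof.
move=> zk; have [w w1 wz] := exists_phase z.
have := zk w w1; rewrite wz -[1]/(1%:C) -rmorphD normc_real ger0_norm.
  by rewrite lerD2l.
by rewrite addr_ge0// normc_ge0.
Qed.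

Section Algebra.
Variable A : preCStarAlgType R.
Implicit Types (f g : {linear A -> R[i]^o}) (u x y z : A).

(** For z in the ball and every phase w, 1 + w f (u' z) is the value of f at u + u' (w z), a point
    of norm at most 1; a suitable phase yields f (u' z) = 0. *)
Lemma convex_functional_eq0 f u u' :
    (forall c d, cnorm c <= 1 -> cnorm d <= 1 -> cnorm (u * c + u' * d) <= 1) ->
    (forall x, normc (f x) <= cnorm x) -> f u = 1 -> forall z, f (u' * z) = 0.
Proof.
move=> uu f1 fu.
have f0 z : cnorm z <= 1 -> f (u' * z) = 0.
  move=> z1; apply: ComplexField.Normc.eq0_normc; apply/le_anti.
  rewrite normc_ge0 andbT; apply: normc_le_of_phases => w w1.
  have -> : 1 + w * f (u' * z) = f (u * 1 + u' * (w *: z)).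
    by rewrite linearD mulr1 fu -scalerAr linearZ.
  rewrite addr0 (le_trans (f1 _))// uu ?cnorm1//.
  by rewrite cnormZ w1 mul1r.
move=> z; have [z0|z0] := eqVneq (cnorm z) 0.
  by rewrite (cnorm0_eq0 _ z0) mulr0 linear0.
have -> : z = (cnorm z)%:C *: ((cnorm z)^-1%:C *: z).
  by rewrite scalerA -rmorphM mulfV// scale1r.
rewrite -scalerAr linearZ f0; first exact: mulr0.
by rewrite cnormZr ger0_norm ?invr_ge0 ?cnorm_ge0// mulVf.
Qed.

(* With b + b' = 1 splitting the algebra like complementary projections up to
   the error of b b'^m, the pair (1 - s + s b'^m, (s/2) f0 + (1 - s/2) f1) plays
   the role of ((1 - s, 1), (s/2, 1 - s/2)) in an l_infinity sum. *)
Lemma separation_of_norming_pairs (b : A) (b' := 1 - b) (m : nat)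
    (f0 f1 g : {linear A -> R[i]^o}) (y : A) (s e : R) :
    (forall a, b * a = a * b) ->
    (forall c d, cnorm c <= 1 -> cnorm d <= 1 -> cnorm (b * c + b' * d) <= 1) ->
    m.+1%:R * cnorm (b * b' ^+ m) <= 1 ->
    (forall x, normc (f0 x) <= cnorm x) -> (forall x, normc (f1 x) <= cnorm x) ->
    (forall x, normc (g x) <= cnorm x) ->
    f0 b = 1 -> f1 b' = 1 -> 0 <= s <= 1 -> e < s -> 2 < m.+1%:R * (s - e) ^+ 2 ->
    cnorm y = 1 -> g y = 1 ->
    cnorm ((1 - s)%:C *: 1 + s%:C *: b' ^+ m - y) <= e ->
  exists2 v, cnorm v <= 1 &
    e < complex.Re ((s / 2)%:C * f0 v + (1 - s / 2)%:C * f1 v - g v).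
Proof.
move=> bc bb bm f0N f1N gN f0b f1b /andP[s0 s1] es me y1 gy xy.
set x := (1 - s)%:C *: 1 + _ in xy; set n := m.+1%:R in bm me.
have n0 : 0 < n by rewrite ltr0n.
have b'0 := convex_functional_eq0 bb f0N f0b.
have bb' c d : cnorm c <= 1 -> cnorm d <= 1 -> cnorm (b' * c + b * d) <= 1.
  by move=> c1 d1; rewrite addrC bb.
have b0 := convex_functional_eq0 bb' f1N f1b.
set h := s - e in me; have h0 : 0 < h by rewrite subr_gt0.
pose k := (h * n)^-1.
have kh : 2 * k < h.
  by rewrite ltr_pdivrMr ?mulr_gt0// mulrA -expr2 mulrC.
(* Up to the small term s b b'^m, moving y by h b z gives b c + b' y with |c| <= (1 - s) + e + h =
   1. Since g attains its norm at y, this forces g to be small, at most k, on b times the ball. *)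
have ybE z : y + h%:C *: (b * z) =
    b * ((1 - s)%:C *: 1 - (x - y) + h%:C *: z) + b' * y + s%:C *: (b * b' ^+ m).
  have -> : s%:C *: (b * b' ^+ m) = b * (s%:C *: b' ^+ m) by rewrite scalerAr.
  rewrite addrAC -mulrDr.
  have -> : (1 - s)%:C *: 1 - (x - y) + h%:C *: z + s%:C *: b' ^+ m = y + h%:C *: z.
    by rewrite addrAC; congr (_ + _); rewrite addrAC; exact: subKr.
  by rewrite mulrDr -scalerAr mulrBl mul1r addrC addrA subrK.
have gb z : cnorm z <= 1 -> normc (g (b * z)) <= k.
  move=> z1; have kE : h * k = n^-1 by rewrite /k invfM mulVKf ?gt_eqF.
  rewrite -(ler_pM2l h0) kE.
  have -> : h * normc (g (b * z)) = normc (h%:C * g (b * z)).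
    by rewrite ComplexField.Normc.normcM normc_real ger0_norm// ltW.
  apply: normc_le_of_phases => w w1.
  have -> : 1 + w * (h%:C * g (b * z)) = g (y + h%:C *: (b * (w *: z))).
    rewrite linearD gy linearZ -scalerAr linearZ; congr (_ + _); exact: mulrCA.
  rewrite (le_trans (gN _))// ybE (le_trans (cnormD _ _))// lerD//.
    apply: bb; last by rewrite y1.
    rewrite (le_trans (cnormD _ _))// (le_trans (lerD (cnormB _ _) (lexx _)))//.
    rewrite !cnormZr cnorm1 cnormZ w1 mul1r !ger0_norm ?subr_ge0 ?(ltW es)//.
    have : h * cnorm z <= h * 1 by rewrite ler_pM2l.
    by rewrite /h; lra.
  rewrite cnormZr ger0_norm// -[n^-1]mul1r ler_pdivlMr// -mulrA [_ * n]mulrC.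
  by rewrite mulr_ile1// mulr_ge0 ?cnorm_ge0// ltW.
(* Here f0 v = 1, f1 v = - f1 y, and g v is within 2 k of -1, so the real part is at least s / 2 -
   (1 - s / 2) + 1 - 2 k = s - 2 k, above e because 2 k < h = s - e. *)
exists (b - b' * y).
  by rewrite -[b in b - _]mulr1 -mulrN bb ?cnorm1 ?cnormN ?y1.
have f0v : f0 (b - b' * y) = 1 by rewrite linearB f0b b'0; exact: subr0.
have f1v : f1 (b - b' * y) = - f1 y.
  have f1b0 : f1 b = 0 by rewrite -[b]mulr1 b0.
  have f1b'y : f1 (b' * y) = f1 y.
    by rewrite mulrBl mul1r linearB b0; exact: subr0.
  by rewrite linearB f1b0 f1b'y; exact: sub0r.
have gv : g (b - b' * y) = g (b * 1) + g (b * y) - 1.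
  by rewrite linearB mulrBl mul1r linearB gy mulr1 opprB; exact: addrA.
have Reg z : cnorm z <= 1 -> complex.Re (g (b * z)) <= k.
  by move=> /gb; apply: le_trans; exact: Re_le_normc.
have := Reg 1; have := Reg y; rewrite y1 cnorm1 lexx => /(_ isT) gy1 /(_ isT) g11.
have f1y : complex.Re (f1 y) <= 1 by rewrite (le_trans (Re_le_normc _))// -y1.
have ReE (p q r : R[i]) :
    complex.Re ((s / 2)%:C * 1 + (1 - s / 2)%:C * - p - (q + r - 1)) =
    s / 2 - (1 - s / 2) * complex.Re p - (complex.Re q + complex.Re r - 1).
  by case: p q r => [? ?] [? ?] [? ?] /=; ring.
rewrite f0v f1v gv [ltRHS]ReE.
have : (1 - s / 2) * complex.Re (f1 y) <= (1 - s / 2) * 1.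
  by rewrite ler_wpM2l//; lra.
by move: kh; rewrite /h; lra.
Qed.

End Algebra.

End LowerBound.

Section CStarLowerBound.
Variables (R : realType) (A : cstarAlgType R).

Lemma BPB_radii_sphere_ge (delta e : R) :
    dim_gt 1 (alg_center A) -> 0 < delta -> delta <= 2^-1 ->
    BPB_radii ((@unit_sphere R (banach A)) `*` (@dual_sphere R (banach A))) delta e ->
  Num.sqrt (2 * delta) <= e.
Proof.
move=> hA d0 d2 [e0 erad]; rewrite leNgt; apply/negP => lte.
set q := Num.sqrt _ in lte.
have q2 : q ^+ 2 = 2 * delta by rewrite sqr_sqrtr// mulr_ge0// ltW.
have q1 : q <= 1 by have : 0 <= q by [exact: sqrtr_ge0]; move: q2; nra.
(* s > e leaves room for the separation, and s < q gives 1 - s^2 / 2 > 1 - delta. *)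
pose s := (e + q) / 2; have es : e < s by rewrite /s; lra.
have sq : s < q by rewrite /s; lra.
have s0 : 0 <= s by lra.
have s1 : s <= 1 by lra.
have s2 : s ^+ 2 < 2 * delta by rewrite -q2 ltrXn2r.
have [m me] : exists m, 2 < m.+1%:R * (s - e) ^+ 2.
  have h0 : 0 < (s - e) ^+ 2 by rewrite exprn_gt0// subr_gt0.
  have := archi_boundP (divr_ge0 (ler0n R 2) (ltW h0)).
  set m := Num.bound _; rewrite ltr_pdivrMr// => hm; exists m.
  by rewrite (lt_le_trans hm)// ler_wpM2r ?(ltW h0)// ler_nat.
have [t [t1 t2 t3]] := exists_central_spread hA.
have half : `|2^-1 : R| = 2^-1 by rewrite ger0_norm// invr_ge0.
pose b : A := (2^-1)%:C *: (1 + sacval t).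
have b'E : 1 - b = (2^-1)%:C *: (1 - sacval t).
  apply/eqP; rewrite subr_eq -scalerDr addrACA addNr addr0 -mulr2n -(scaler_nat 2 (1 : A)).
  by rewrite scalerA -(rmorph_nat (real_complex R)) -rmorphM mulVf ?pnatr_eq0// scale1r.
have bc a : b * a = a * b.
  by rewrite -scalerAl -scalerAr mulrDl mulrDr mul1r mulr1 sacenter_central.
have bb c d : cnorm c <= 1 -> cnorm d <= 1 -> cnorm (b * c + (1 - b) * d) <= 1.
  move=> c1 d1; rewrite b'E -!scalerAl -scalerDr cnormZr half.
  by rewrite ler_pdivrMl// mulr1 cnorm_central_convex.
(* The Bernstein bound of degree m + 1 and index 1. *)
have bm : m.+1%:R * cnorm (b * (1 - b) ^+ m) <= 1.
  have := cnorm_bernstein_le m.+1 1 t1; rewrite bin1 expr1 subn1 /= => tm.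
  rewrite b'E exprZn -scalerAl -scalerAr scalerA -exprS -rmorphXn cnormZr.
  rewrite ger0_norm ?exprn_ge0 ?invr_ge0// exprVn mulrCA.
  by rewrite ler_pdivrMl ?exprn_gt0// mulr1.
have b1 : cnorm b = 1.
  by rewrite cnormZr half [cnorm _]t2 mulVf ?pnatr_eq0.
have b'1 : cnorm (1 - b) = 1.
  by rewrite b'E cnormZr half [cnorm _]t3 mulVf ?pnatr_eq0.
have [f0' f0N' f0b'] := exists_norming_functional (b1 : rnorm (b : banach A) = 1).
have [f1' f1N' f1b'] := exists_norming_functional (b'1 : rnorm (1 - b : banach A) = 1).
(* Retyping from [banach A] to [A] makes the product available on arguments. *)
pose f0 : {linear A -> R[i]^o} := f0'; pose f1 : {linear A -> R[i]^o} := f1'.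
have f0N (z : A) : normc (f0 z) <= cnorm z := f0N' z.
have f1N (z : A) : normc (f1 z) <= cnorm z := f1N' z.
have f0b : f0 b = 1 := f0b'.
have f1b : f1 (1 - b) = 1 := f1b'.
have f0_b' := convex_functional_eq0 bb f0N f0b.
have bb' c d : cnorm c <= 1 -> cnorm d <= 1 -> cnorm ((1 - b) * c + b * d) <= 1.
  by move=> c1 d1; rewrite addrC bb.
have f1_b := convex_functional_eq0 bb' f1N f1b.
have f01 : f0 1 = 1.
  by rewrite -(subrK b 1) linearD f0b -[1 - b]mulr1 f0_b'; exact: add0r.
have f11 : f1 1 = 1.
  by rewrite -(subrK b 1) linearD f1b -[b]mulr1 f1_b; exact: addr0.
pose f : {linear A -> R[i]^o} := ((s / 2)%:C \*: f0) \+ ((1 - s / 2)%:C \*: f1).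
have fE z : f z = (s / 2)%:C * f0 z + (1 - s / 2)%:C * f1 z by [].
have fN z : normc (f z) <= cnorm z.
  rewrite fE (le_trans (le_normcD _ _))// !ComplexField.Normc.normcM !normc_real.
  rewrite !ger0_norm; [|lra|lra].
  have : s / 2 * normc (f0 z) <= s / 2 * cnorm z by rewrite ler_wpM2l//; lra.
  have : (1 - s / 2) * normc (f1 z) <= (1 - s / 2) * cnorm z.
    by rewrite ler_wpM2l//; lra.
  by lra.
pose f' : {linear banach A -> R[i]^o} := f.
have f'N z : normc (f' z) <= 1 * rnorm z by rewrite mul1r; exact: fN.
have f'd : dual_space f' := bounded_dual_space f'N.
have f'1 : f' (1 : A) = 1.
  rewrite [LHS]fE f01 f11; apply/eqP; rewrite eq_complex /=.
  by apply/andP; split; apply/eqP; ring.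
have f'sphere : dual_sphere f'.
  split=> //=; apply/le_anti/andP; split.
    by apply: opnorm_le => z z1; rewrite (le_trans (f'N z))// mul1r.
  have := le_opnorm ((1 : A) : banach A) f'd; rewrite f'1 ComplexField.Normc.normc1.
  by rewrite [rnorm _]cnorm1 mulr1.
(* A factor 1 - b is needed for f0 to vanish on (1 - b)^m; m = 0 is excluded since (s - e)^2 <=
   1. *)
have mpos : exists n, m = n.+1.
  case: (m) me => [|n _]; last by exists n.
  have : (s - e) ^+ 2 <= 1 by rewrite exprn_ile1//; lra.
  by rewrite mul1r; lra.
have f1b'm n : f1 ((1 - b) ^+ n) = 1.
  elim: n => [|n IH]; first by rewrite expr0.
  by rewrite exprS mulrBl mul1r linearB f1_b IH; exact: subr0.
have f0b'm : f0 ((1 - b) ^+ m) = 0 by case: mpos => n ->; rewrite exprS f0_b'.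
pose x : A := (1 - s)%:C *: 1 + s%:C *: (1 - b) ^+ m.
have linZ (h : {linear A -> R[i]^o}) c (z : A) : h (c *: z) = c * h z.
  exact: linearZ_LR.
have f0x : f0 x = (1 - s)%:C * 1 + s%:C * 0 by rewrite linearD !linZ f01 f0b'm.
have f1x : f1 x = (1 - s)%:C * 1 + s%:C * 1 by rewrite linearD !linZ f11 f1b'm.
have x1 : cnorm x = 1.
  apply/le_anti/andP; split.
    rewrite (le_trans (cnormD _ _))// !cnormZr cnorm1 !ger0_norm ?subr_ge0//.
    have : s * cnorm ((1 - b) ^+ m) <= s * 1 by rewrite ler_wpM2l// cnormX_le1// b'1.
    by lra.
  rewrite (le_trans _ (f1N x))// f1x !mulr1 -rmorphD subrK.
  by rewrite ComplexField.Normc.normc1.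
have fx : 1 - delta < complex.Re (f x).
  have -> : complex.Re (f x) = 1 - s ^+ 2 / 2.
    have ReE (r : R) : complex.Re ((r / 2)%:C * ((1 - r)%:C * 1 + r%:C * 0) +
        (1 - r / 2)%:C * ((1 - r)%:C * 1 + r%:C * 1)) = 1 - r ^+ 2 / 2.
      by rewrite /=; ring.
    by rewrite fE f0x f1x; exact: ReE.
  by move: s2; lra.
have [|//|y [g' [[/= yS [gd g1] gy] xy fg]]] := erad (x : banach A) f'.
  by split=> //=; rewrite /unit_sphere /= rnormE [rnorm _]x1.
have y1 : cnorm (y : A) = 1 by apply: complexI; exact: yS.
have {}xy : cnorm (x - (y : A)) <= e by rewrite ltW// -ltcR.
pose g : {linear A -> R[i]^o} := g'.
have gN (z : A) : normc (g z) <= cnorm z.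
  by have := le_opnorm (z : banach A) gd; rewrite [opnorm _]g1 mul1r.
have [|v v1 ev] := separation_of_norming_pairs bc bb bm f0N f1N gN f0b f1b _ es me y1 gy xy.
  by rewrite s0 s1.
pose d' : {linear banach A -> R[i]^o} := f' \- g'.
have d'N z : normc (d' z) <= 2 * rnorm z.
  rewrite (le_trans (le_normcD _ _))// normcN.
  have := gN z; have := fN z; rewrite -[rnorm z]/(cnorm (z : A)); lra.
have := le_opnorm (v : banach A) (bounded_dual_space d'N).
have : opnorm d' * cnorm v <= opnorm d' * 1 by rewrite ler_wpM2l// opnorm_ge0.
have := Re_le_normc (d' v).
have : opnorm d' < e := fg.
have {}ev : e < complex.Re (d' v) := ev.
by rewrite -[rnorm _]/(cnorm v); lra.
Qed.

End CStarLowerBound.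

Theorem mainTheorem13 (R : realType) (A : cstarAlgType R)
    (hA : dim_gt 1 (alg_center A)) (delta : R)
    (delta_gt0 : 0 < delta) (delta_le : delta <= 2^-1) :
  BPB_modulus (banach A) delta = Num.sqrt (2 * delta) /\
  BPB_modulusS (banach A) delta = Num.sqrt (2 * delta).
Proof.
pose X := banach A.
have sphere_ball : (@unit_sphere R X) `*` (@dual_sphere R X) `<=`
    (@unit_ball R X) `*` (@dual_ball R X).
  move=> [x f] [/= xS [fd fS]]; split; first by rewrite /unit_ball /= xS.
  by split=> //=; rewrite fS.
(* Radii for the balls are radii for the spheres, so the upper bound on balls and the lower bound on
   spheres settle both moduli. *)
have radii_ball e : BPB_radii ((@unit_ball R X) `*` (@dual_ball R X)) delta e ->
    BPB_radii ((@unit_sphere R X) `*` (@dual_sphere R X)) delta e.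
  by move=> [e0 eD]; split=> // x f /sphere_ball/eD.
have inf_sqrt D : D `<=` (@unit_ball R X) `*` (@dual_ball R X) ->
    (forall e, BPB_radii D delta e -> Num.sqrt (2 * delta) <= e) ->
    inf (BPB_radii D delta) = Num.sqrt (2 * delta).
  move=> DB Dlb; apply/le_anti/andP; split.
    apply/ler_addgt0Pr => e e0; apply: ge_inf; first by exists (Num.sqrt (2 * delta)).
    by apply: gt_sqrt_BPB_radii; rewrite ?ltrDl.
  (* A witness of nonemptiness, as the infimum of the empty set is 0 by convention. *)
  apply: lb_le_inf => //; exists (Num.sqrt (2 * delta) + 1).
  by apply: gt_sqrt_BPB_radii; rewrite ?ltrDl.
have sphere_ge e : BPB_radii ((@unit_sphere R X) `*` (@dual_sphere R X)) delta e ->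
    Num.sqrt (2 * delta) <= e by exact: BPB_radii_sphere_ge.
by split; apply: inf_sqrt => // e /radii_ball/sphere_ge.
Qed.
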